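(* Fix integers $g\ge 1$ and $n\ge 1$, and let $t=2g+n-1$. For a tuple $\beta=(\beta_1,\ldots,\beta_n)$ of positive integers with $d=\beta_1+\cdots+\beta_n$, the number $\mathsf{H}^g_{d,d}(\beta)/(t!\,d)$ is given by a symmetric polynomial in $\beta_1,\ldots,\beta_n$ of highest degree $4g+n-3$ and lowest degree $2g+n-3$. For nonnegative integers $b_1,\ldots,b_n$ with $b=b_1+\cdots+b_n\ge 2g-3$ and $b+2k=4g+n-3$ for an integer $k\ge 0$, the coefficient of $\beta_1^{b_1}\cdots\beta_n^{b_n}$ satisfies $$(-1)^{\frac{4g-3+n-b}{2}}\langle\langle\tau_{b_1}\cdots\tau_{b_n}\Lambda_{2k}\rangle\rangle'_g=\mathbf{C}_{b,g,n}\,\widehat{\mathbf{C}}_g(b_1,\ldots,b_n),$$ where $$\widehat{\mathbf{C}}_g(b_1,\ldots,b_n)=[x^{2g+n-3}]\,(2g+n-3)!\,(b+3-2g)!\prod_{i=1}^n\frac{(x+1)^{b_i+1}-(x-1)^{b_i+1}}{(b_i+1)!}.$$ In particular, if $b+n$ is even then $\langle\langle\tau_{b_1}\cdots\tau_{b_n}\Lambda_{2k}\rangle\rangle'_g=0$. Moreover, if $b_1+\cdots+b_n=2g+n-3$, then $$\langle\langle\tau_{b_1}\cdots\tau_{b_n}\Lambda_{2g}\rangle\rangle'_g=(-1)^g\binom{2g+n-3}{b_1,\ldots,b_n}\frac{1-2^{2g-1}}{2^{2g-1}(2g)!}B_{2g}.$$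
   Context: For a partition $\beta=[1^{a_1},\ldots,d^{a_d}]\vdash d$ with $n$ parts (a tuple is identified with its sorted partition), $\mathrm{Aut}(\beta)=\prod_i a_i!$, and $\mathsf{H}^g_{d,d}(\beta)=\frac{\mathrm{Aut}(\beta)}{d!}N$ where $N$ is the number of tuples $(\sigma_0,\tau_1,\ldots,\tau_t,\sigma_{t+1})$ in $\mathfrak{S}_d$, $t=2g-1+n$, with $\sigma_0$ a $d$-cycle, each $\tau_i$ a transposition, $\sigma_{t+1}$ of cycle type $\beta$, and $\sigma_0\tau_1\cdots\tau_t\sigma_{t+1}$ equal to the identity (i.e., having $d$ cycles). For $b_i\ge0$, $k\ge 0$ with $b_1+\cdots+b_n+2k=4g-3+n$, define $\langle\langle\tau_{b_1}\cdots\tau_{b_n}\Lambda_{2k}\rangle\rangle'_g=(-1)^k[\beta_1^{b_1}\cdots\beta_n^{b_n}]\frac{\mathsf{H}^g_{d,d}(\beta)}{t!\,d}$ (coefficient in the polynomial above), and set it to $0$ otherwise. $\mathbf{C}_{b,g,n}=\frac{1}{(b+3-2g)!}\sum_{k=0}^{2g+n}\frac{1}{(k+2g-b-3)!}\frac{B_{2g+n-k}}{(2g+n-k)!2^k}$ with $1/r!=0$ for $r<0$, where $B_r$ are the Bernoulli numbers, $\frac{x}{e^x-1}=\sum_r B_r\frac{x^r}{r!}$. $[x^j]$ denotes coefficient extraction. *)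

(* Defs.v *)
From HB Require Import structures.
From mathcomp Require Import all_boot all_order all_algebra all_fingroup.
From mathcomp Require Export mpoly.

Set Implicit Arguments.
Unset Strict Implicit.
Unset Printing Implicit Defensive.

Import Order.TTheory GRing.Theory Num.Theory.
Local Open Scope ring_scope.

Definition cycle_type_seq (d : nat) (s : {perm 'I_d}) : seq nat :=
  [seq #|X| | X : {set 'I_d} in porbits s]%N.

Definition has_cycle_type (d : nat) (s : {perm 'I_d}) (beta : seq nat) : bool :=
  perm_eq (cycle_type_seq s) beta.

Definition hurwitz_count (d t : nat) (beta : seq nat) : nat :=
  #|[set x : {perm 'I_d} * {ffun 'I_t -> {perm 'I_d}} * {perm 'I_d} |
      [&& has_cycle_type x.1.1 [:: d],
          [forall i, [exists y : 'I_d * 'I_d, (y.1 != y.2) && (x.1.2 i == tperm y.1 y.2)]],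
          has_cycle_type x.2 beta &
          (x.1.1 * (\prod_(i < t) x.1.2 i) * x.2 == 1)%g]]|.

Definition aut_part (d : nat) (beta : seq nat) : nat :=
  \prod_(i < d.+1) (count_mem (i : nat) beta)`!.

Definition hurwitzH (g : nat) (beta : seq nat) : rat :=
  let d := sumn beta in
  let t := (2 * g - 1 + size beta)%N in
  (aut_part d beta)%:R / (d`!)%:R * (hurwitz_count d t beta)%:R.

(* Bernoulli numbers, defined by x/(e^x-1) = sum_r B_r x^r/r!, i.e.
   (sum_r B_r x^r / r!) * (sum_j x^j/(j+1)!) = 1, i.e.
   sum_{j=0}^m B_j / (j! (m-j+1)!) = [m == 0].  (So B_1 = -1/2.)       *)
Fixpoint bern_seq (m : nat) : seq rat :=
  match m with
  | 0 => [:: 1]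
  | m'.+1 =>
      let s := bern_seq m' in
      rcons s (- (m'.+1)`!%:R *
               \sum_(j < m'.+1) s`_j / ((j`!)%:R * ((m'.+2 - j)`!)%:R))
  end.

Definition bernoulli (r : nat) : rat := (bern_seq r)`_r.

Definition invfact (z : int) : rat :=
  match z with
  | Posz m => ((m`!)%:R)^-1
  | Negz _ => 0
  end.

Definition Cbgn (b g n : nat) : rat :=
  invfact (b%:Z + 3 - 2 * g%:Z) *
  \sum_(k < (2 * g + n).+1)
     invfact (k%:Z + 2 * g%:Z - b%:Z - 3) *
     (bernoulli (2 * g + n - k) / (((2 * g + n - k)`!)%:R * (2 ^ k)%:R)).

(* \hat C_g(b_1..b_n); b = sum b_i, assumed >= 2g-3 where used. *)
Definition Chat (g n : nat) (bs : n.-tuple nat) : rat :=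
  let b := sumn bs in
  ((2 * g + n - 3)`!)%:R * ((b + 3 - 2 * g)`!)%:R *
  (\prod_(i < n)
     ((('X + 1) ^+ (tnth bs i).+1 - ('X - 1) ^+ (tnth bs i).+1)
        * (((tnth bs i).+1`!)%:R)^-1%:P) : {poly rat})`_(2 * g + n - 3).

Definition mono_of (n : nat) (bs : n.-tuple nat) : 'X_{1..n} :=
  [multinom tnth bs i | i < n].

(* << tau_{b_1} ... tau_{b_n} Lambda_{2k} >>'_g, relative to the polynomial P
   representing H^g_{d,d}(beta)/(t! d):  (-1)^k [beta^b] P  if
   b_1+..+b_n + 2k = 4g-3+n, and 0 otherwise. *)
Definition bracket (g n : nat) (P : {mpoly rat[n]}) (bs : n.-tuple nat) (k : nat)
  : rat :=
  if (sumn bs + 2 * k == 4 * g - 3 + n)%N then (-1) ^+ k * P@_(mono_of bs) else 0.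

Definition multinomial (n : nat) (bs : n.-tuple nat) : rat :=
  ((sumn bs)`!)%:R / (\prod_(i < n) ((tnth bs i)`!)%:R).

(* Main.v *)
Require Import Defs.
From mathcomp Require Import all_boot all_order all_algebra all_fingroup.
From mathcomp Require Import mpoly.
From mathcomp Require Import zify ring lra.

Set Implicit Arguments.
Unset Strict Implicit.
Unset Printing Implicit Defensive.

Import Order.TTheory GRing.Theory Num.Theory.
Local Open Scope ring_scope.

(** Multiplying a permutation by a transposition cuts one of its cycles or joins
two of them. With [B(s)] the product of [q^|X| - 1] over the cycles [X] of [s]
and [Q(s) = B(s)/(q - 1)], this gives the cut-and-join equation
[d (q d/dq - (d-1)/2) Q(s) = \sum_tau Q(s tau)] (sum over transpositions).
Since [Q(s)] at [q = 1] is [d] if [s] is a [d]-cycle and [0] otherwise, the number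
of ways to write [s] as a [d]-cycle times [t] transpositions is [d^(t-1)] times the
[t]-th derivative at [z = 0] of [q^(-(d-1)/2) Q(s)], [q = e^z]. The size of a
conjugacy class follows from the same cut and join moves, applied to permutations
with one marked point in each cycle, and one gets the formula of Goulden, Jackson
and Vakil
[H/(t! d) = d^(2g+n-3) [z^(2g)] \prod_i S(beta_i z) / S(z)], [S(z) = sinh(z/2)/(z/2)].
Its right-hand side is a polynomial, whose coefficients are read off from
[d^D = D! [w^D] \prod_i e^(beta_i w)] and [1/S(z) = e^(z/2) z/(e^z - 1)].
The lowest-degree part is nonzero because the Riccati equation of
[(z/2) coth(z/2)] makes the even coefficients of [1/S] alternate in sign. *)

(** * Cutting and joining cycles *)

Section CutJoin.

Variable T : finType.
Implicit Types (s : {perm T}) (x y z : T).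

Lemma iter_porbit_inj s x i j :
  (i < #|porbit s x|)%N -> (j < #|porbit s x|)%N -> iter i s x = iter j s x ->
  i = j.
Proof.
move=> lt_i lt_j eq_ij; apply/eqP.
rewrite -(nth_uniq x _ _ (uniq_traject_porbit s x)) ?size_traject //.
by rewrite !nth_traject // eq_ij.
Qed.

Lemma mem_porbit_iter s x i : iter i s x \in porbit s x.
Proof. by rewrite -permX mem_porbit. Qed.

Lemma eq_porbit s x y : y \in porbit s x -> porbit s y = porbit s x.
Proof. by move=> sxy; apply/eqP; rewrite eq_porbit_mem. Qed.

Lemma porbitP_iter s x y :
  y \in porbit s x -> exists2 i, (i < #|porbit s x|)%N & y = iter i s x.
Proof. by rewrite porbit_traject => /trajectP. Qed.

Lemma card_porbit_iter s x r :
  (0 < r)%N -> iter r s x = x ->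
  (forall i j, (i < r)%N -> (j < r)%N -> iter i s x = iter j s x -> i = j) ->
  #|porbit s x| = r.
Proof.
move=> r_gt0 srx inj_s; apply/eqP; rewrite eqn_leq; apply/andP; split.
  rewrite leqNgt; apply/negP => lt_r.
  have := @iter_porbit_inj s x r 0 lt_r (ltn_trans r_gt0 lt_r) srx.
  by move=> r0; rewrite r0 in r_gt0.
have Ur : uniq (traject s x r).
  apply/(uniqP x) => i j; rewrite !inE size_traject => lt_i lt_j.
  by rewrite !nth_traject //; apply: inj_s.
rewrite -[leqLHS](size_traject s x) -(card_uniqP Ur); apply: subset_leq_card.
by apply/subsetP => _ /trajectP[i _ ->]; apply: mem_porbit_iter.
Qed.

Lemma porbit_mul_tperm_out s x y z :
  x \notin porbit s z -> y \notin porbit s z ->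
  porbit (s * tperm x y)%g z = porbit s z.
Proof.
move=> xz yz; set u := (s * _)%g.
have iterE n : iter n u z = iter n s z.
  elim: n => //= n ->; rewrite permM tpermD //.
    by apply: contraNneq xz => ->; rewrite -iterS mem_porbit_iter.
  by apply: contraNneq yz => ->; rewrite -iterS mem_porbit_iter.
apply/setP => w; apply/porbitP/porbitP => -[i ->]; exists i.
  by rewrite !permX iterE.
by rewrite !permX iterE.
Qed.

Section Cut.

Variables (s : {perm T}) (x : T) (r : nat).
Hypotheses (r_gt0 : (0 < r)%N) (lt_r : (r < #|porbit s x|)%N).
Let y := iter r s x.
Let u := (s * tperm x y)%g.
Let k := #|porbit s x|.

(** Permutations compose from left to right, so [u] follows [s] until [s] would reach [y] or [x]. On
    arrival at [y] the swap closes the orbit of [x], and on arrival at [x] it closes the orbit of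
    [y]. *)
Let u_lt i : (i < r)%N -> iter i u x = iter i s x.
Proof.
elim: i => //= i IH lt_i; rewrite IH 1?ltnW // permM -iterS tpermD //.
  by apply/eqP => /(@iter_porbit_inj _ _ 0 i.+1); lia.
by apply/eqP => /(@iter_porbit_inj _ _ r i.+1); lia.
Qed.

Let u_r : iter r u x = x.
Proof.
have -> : r = r.-1.+1 by lia.
rewrite iterS u_lt; last lia.
by rewrite permM -iterS prednK // tpermR.
Qed.

Let u_ge i : (i < k - r)%N -> iter i u y = iter (i + r) s x.
Proof.
elim: i => //= i IH lt_i; rewrite IH 1?ltnW // permM -iterS tpermD //.
  by apply/eqP => /(@iter_porbit_inj _ _ 0 (i + r).+1); lia.
by apply/eqP => /(@iter_porbit_inj _ _ r (i + r).+1); lia.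
Qed.

Let u_k : iter (k - r) u y = y.
Proof.
have -> : (k - r = (k - r).-1.+1)%N by lia.
rewrite iterS u_ge; last lia.
rewrite permM -iterS -addSn prednK ?subn_gt0 // subnK 1?ltnW //.
by rewrite iter_porbit tpermL.
Qed.

Lemma card_porbit_cutl : #|porbit u x| = r.
Proof.
apply: card_porbit_iter => // i j lt_i lt_j; rewrite !u_lt //.
by apply: iter_porbit_inj; lia.
Qed.

Lemma card_porbit_cutr : #|porbit u y| = (k - r)%N.
Proof.
apply: card_porbit_iter => // [|i j lt_i lt_j]; first by rewrite subn_gt0.
by rewrite !u_ge // => /iter_porbit_inj; lia.
Qed.

Lemma porbit_cut_neq : porbit u x != porbit u y.
Proof.
rewrite eq_sym eq_porbit_mem; apply/negP => /porbitP_iter[i].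
rewrite card_porbit_cutl => lt_i; rewrite u_lt // => /iter_porbit_inj.
lia.
Qed.

Lemma porbit_cut_out z : z \notin porbit s x -> porbit u z = porbit s z.
Proof.
move=> xz; apply: porbit_mul_tperm_out; rewrite porbit_sym //.
by rewrite (eq_porbit (mem_porbit_iter s x r)).
Qed.

Lemma porbits_cut :
  porbits u :\ porbit u x :\ porbit u y = porbits s :\ porbit s x.
Proof.
apply/setP => W; rewrite !inE; apply/and3P/andP.
  move=> [Wy Wx /imsetP[z _ defW]]; rewrite {W}defW in Wx Wy *.
  suff xz : z \notin porbit s x.
    by rewrite porbit_cut_out // imset_f // eq_porbit_mem.
  apply/negP => /porbitP_iter[i lt_i def_z].
  have [lt_ir|le_ri] := ltnP i r.
    by case/eqP: Wx; apply: eq_porbit; rewrite def_z -u_lt // mem_porbit_iter.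
  case/eqP: Wy; apply: eq_porbit; rewrite def_z -(subnK le_ri) -u_ge ?mem_porbit_iter //.
  by lia.
move=> [Wx /imsetP[z _ defW]]; rewrite {W}defW eq_porbit_mem in Wx *.
split; last by rewrite -(porbit_cut_out Wx) imset_f.
  apply: contraNneq Wx => e; rewrite -(eq_porbit (mem_porbit_iter s x r)).
  by rewrite porbit_sym e porbit_id.
by apply: contraNneq Wx => e; rewrite porbit_sym e porbit_id.
Qed.

End Cut.

Section Join.

Variables (s : {perm T}) (x y : T).
Hypothesis (xy : y \notin porbit s x).
Let u := (s * tperm x y)%g.
Let k := #|porbit s x|.

Let k_gt0 : (0 < k)%N. Proof. by rewrite lt0n card_porbit_neq0. Qed.

Let u_lt i : (i < k)%N -> iter i u x = iter i s x.
Proof.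
elim: i => //= i IH lt_i; rewrite IH 1?ltnW // permM -iterS tpermD //.
  by apply/eqP => /(@iter_porbit_inj _ _ 0 i.+1); lia.
by apply: contraNneq xy => ->; apply: mem_porbit_iter.
Qed.

Lemma iter_join : iter k u x = y.
Proof.
have -> : k = k.-1.+1 by lia.
rewrite iterS u_lt; last lia.
by rewrite permM -iterS prednK // iter_porbit tpermL.
Qed.

(** A join is undone by a cut at [iter k u x]. The length and the remaining cycles after a join thus
    follow from the lemmas on cuts, applied to [u]. *)
Lemma joinK : (u * tperm x (iter k u x))%g = s.
Proof. by rewrite iter_join -mulgA tperm2 mulg1. Qed.

Lemma ltn_porbit_join : (k < #|porbit u x|)%N.
Proof.
have sub : y |: porbit s x \subset porbit u x.
  apply/subsetP => z; rewrite !inE => /predU1P[->|].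
    by rewrite -iter_join mem_porbit_iter.
  by move=> /porbitP_iter[i lt_i ->]; rewrite -u_lt // mem_porbit_iter.
by have := subset_leq_card sub; rewrite cardsU1 xy.
Qed.

Lemma card_porbit_join : #|porbit u x| = (k + #|porbit s y|)%N.
Proof.
have := card_porbit_cutr k_gt0 ltn_porbit_join.
by rewrite joinK iter_join; have := ltn_porbit_join; lia.
Qed.

Lemma porbits_join :
  porbits u :\ porbit u x = porbits s :\ porbit s x :\ porbit s y.
Proof. by have := porbits_cut k_gt0 ltn_porbit_join; rewrite joinK iter_join. Qed.

End Join.

End CutJoin.

(** * The cut-and-join equation *)

Lemma deriv_prod_set (R : comNzRingType) (I : finType) (A : {set I})
    (F : I -> {poly R}) :
  (\prod_(i in A) F i)^`() =
  \sum_(i in A) (F i)^`() * \prod_(j in A :\ i) F j.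
Proof.
have [m] := ubnP #|A|; elim: m A => // m IH A /ltnSE le_m.
have [->|[x Ax]] := set_0Vmem A.
  by rewrite !big_set0 derivC.
rewrite (big_setD1 x) //= derivM IH; last first.
  by rewrite (cardsD1 x) Ax in le_m *; apply: leq_trans le_m.
rewrite [RHS](big_setD1 x) //=; congr (_ + _).
rewrite mulr_sumr; apply: eq_bigr => i /setD1P[ix Ai].
rewrite [in RHS](big_setD1 x) /=; last by rewrite !inE eq_sym ix.
by rewrite !setDDl setUC mulrCA.
Qed.

(** With ['X] as $q$, this is $q - 1$ times the $q$-integer of [k]. *)
Definition qnum (k : nat) : {poly rat} := 'X^k - 1.

Lemma qnum_deriv k : 'X * (qnum k)^`() = k%:R * 'X^k.
Proof.
rewrite /qnum derivB derivXn derivC subr0.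
by case: k => [|k]; rewrite ?mulr0n ?mulr0 ?mul0r // exprS mulr_natl mulrnAr.
Qed.

(** The form is adapted to joins: the first two terms will match the cross terms of the derivative
    of a product, the last one the cross terms of $d^2$. *)
Lemma qnumD k l :
  qnum (k + l) = 'X^k * qnum l + 'X^l * qnum k - qnum k * qnum l.
Proof. rewrite /qnum exprD; ring. Qed.

(** Expand $(q^r-1)(q^{k-r}-1) = q^k + 1 - q^r - q^{k-r}$ and sum the geometric series. The
    right-hand side is arranged as the one-cycle case of the cut-and-join equation, without its
    common factor [k]. *)
Lemma sum_qnum_cut k :
  ('X - 1) * (\sum_(1 <= r < k) qnum r * qnum (k - r)) =
  k%:R * (2 * ('X - 1) * 'X^k) - 2 * 'X * qnum k
  - (k%:R - 1) * ('X - 1) * qnum k.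
Proof.
case: k => [|k]; first by rewrite big_geq // /qnum expr0; ring.
suff -> : \sum_(1 <= r < k.+1) qnum r * qnum (k.+1 - r) =
   k%:R * ('X^(k.+1) + 1) - 2 * \sum_(1 <= r < k.+1) 'X^r.
  have : ('X - 1) * (\sum_(1 <= r < k.+1) 'X^r) = 'X^(k.+1) - 'X :> {poly rat}.
    rewrite big_add1 /= big_mkord.
    under eq_bigr do rewrite exprS.
    by rewrite -mulr_sumr mulrCA -subrX1 exprS; ring.
  move=> e; rewrite mulrBr [_ * (2 * _)]mulrCA e /qnum -natr1; ring.
transitivity (\sum_(1 <= r < k.+1) ('X^(k.+1) + 1 - ('X^r + 'X^(k.+1 - r))) : {poly rat}).
  rewrite !big_nat; apply: eq_bigr => r /andP[_ lt_r].
  have -> : 'X^(k.+1) = 'X^(k.+1 - r) * 'X^r :> {poly rat}.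
    by rewrite -exprD subnK // ltnW.
  by rewrite /qnum; ring.
have rev : \sum_(1 <= r < k.+1) 'X^(k.+1 - r) = \sum_(1 <= r < k.+1) 'X^r :> {poly rat}.
  rewrite big_nat_rev /= !big_nat; apply: eq_bigr => r lt_r.
  by congr ('X^_); lia.
rewrite sumrB sumr_const_nat big_split /= rev subSS subn0 mulr_natl.
by rewrite mulr2n mulrDl mul1r.
Qed.

(* The two kinds of terms on the left come from a transposition cutting one cycle
   or joining two. *)
Lemma cut_join_prod (I : finType) (A : {set I}) (k : I -> nat) :
  let d : {poly rat} := (\sum_(i in A) k i)%N%:R in
  let B := \prod_(i in A) qnum (k i) in
  ('X - 1) * (\sum_(i in A) (k i)%:R *
     ((\sum_(1 <= r < k i) qnum r * qnum (k i - r))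
        * \prod_(l in A :\ i) qnum (k l)
      + \sum_(j in A :\ i) (k j)%:R *
           (qnum (k i + k j) * \prod_(l in A :\ i :\ j) qnum (k l)))) =
  d * (2 * ('X - 1) * ('X * B^`()) - 2 * 'X * B - (d - 1) * ('X - 1) * B).
Proof.
move=> d B.
pose P i := \prod_(l in A :\ i) qnum (k l).
pose P2 i j := \prod_(l in A :\ i :\ j) qnum (k l).
pose S1 := \sum_(i in A) \sum_(j in A :\ i)
  (k i)%:R * ((k j)%:R * ('X^(k i) * qnum (k j) * P2 i j)).
pose S2 := \sum_(i in A) \sum_(j in A :\ i)
  (k i)%:R * ((k j)%:R * ('X^(k j) * qnum (k i) * P2 i j)).
pose S3 := \sum_(i in A) \sum_(j in A :\ i)
  (k i)%:R * ((k j)%:R * (qnum (k i) * qnum (k j) * P2 i j)).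
(* [S1] and [S2] hold the cross terms of the derivative, [S3] those of $d^2$. Exchanging $i$ and $j$
   identifies the first two, so the coefficient 2 of the derivative supplies one copy of each. *)
have S12 : S1 = S2.
  rewrite /S1 /S2 !pair_big_dep /=.
  rewrite (reindex_inj (h := fun p : I * I => (p.2, p.1))) /=; last first.
    by move=> [a b] [a' b'] /= [-> ->].
  apply: eq_big => [[a b]|[a b] _] /=.
    by rewrite !inE eq_sym; case: (a \in A); case: (b \in A); rewrite ?andbF.
  have -> : P2 b a = P2 a b by rewrite /P2 !setDDl setUC.
  by rewrite !mulrA [(k a)%:R * _]mulrC; ring.
have BE i : i \in A -> B = qnum (k i) * P i.
  by move=> Ai; rewrite /B (big_setD1 i).
have PE i j : j \in A :\ i -> P i = qnum (k j) * P2 i j.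
  by move=> Aj; rewrite /P (big_setD1 j).
have dE i : i \in A -> d = (k i)%:R + \sum_(j in A :\ i) (k j)%:R.
  by move=> Ai; rewrite /d (big_setD1 i) //= natrD natr_sum.
have dB : d * B = \sum_(i in A) (k i)%:R * (qnum (k i) * P i).
  by rewrite /d natr_sum mulr_suml; apply: eq_bigr => i Ai; rewrite (BE i Ai).
have ddB : d * ((d - 1) * B) =
    \sum_(i in A) (k i)%:R * (((k i)%:R - 1) * (qnum (k i) * P i)) + S3.
  rewrite {1}/d natr_sum mulr_suml -big_split /=; apply: eq_bigr => i Ai.
  rewrite -mulr_sumr -mulrDr; congr (_ * _).
  rewrite {1}(dE i Ai) -(BE i Ai) addrAC mulrDl; congr (_ + _).
  rewrite mulr_suml; apply: eq_bigr => j Aj; congr (_ * _).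
  by rewrite (BE i Ai) (PE i j Aj) mulrA.
have dB' : d * ('X * B^`()) =
    \sum_(i in A) (k i)%:R * ((k i)%:R * ('X^(k i) * P i)) + S1.
  rewrite /B deriv_prod_set 2!mulr_sumr -big_split /=; apply: eq_bigr => i Ai.
  rewrite [X in d * X]mulrA qnum_deriv {1}(dE i Ai) mulrDl; congr (_ + _).
    by rewrite -/(P i); ring.
  rewrite mulr_suml; apply: eq_bigr => j Aj.
  by rewrite -/(P i) (PE i j Aj); ring.
have -> : d * (2 * ('X - 1) * ('X * B^`()) - 2 * 'X * B - (d - 1) * ('X - 1) * B)
  = 2 * ('X - 1) * (d * ('X * B^`())) - 2 * 'X * (d * B)
     - ('X - 1) * (d * ((d - 1) * B)) by ring.
rewrite dB' dB ddB.
have -> : 2 * ('X - 1) * (\sum_(i in A) (k i)%:R * ((k i)%:R * ('X^(k i) * P i)) + S1)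
  = \sum_(i in A) (k i)%:R * ((k i)%:R * (2 * ('X - 1) * 'X^(k i)) * P i)
    + ('X - 1) * (S1 + S2).
  rewrite -S12 mulrDr mulr_sumr; congr (_ + _); last by ring.
  by apply: eq_bigr => i _; ring.
rewrite mulr_sumr mulr_sumr [('X - 1) * (_ + S3)]mulrDr [('X - 1) * (\sum_(i in A) _)]mulr_sumr.
transitivity (\sum_(i in A) ((k i)%:R * ((k i)%:R * (2 * ('X - 1) * 'X^(k i)) * P i)
   - 2 * 'X * ((k i)%:R * (qnum (k i) * P i))
   - ('X - 1) * ((k i)%:R * (((k i)%:R - 1) * (qnum (k i) * P i))))
   + ('X - 1) * (S1 + S2 - S3)); last by rewrite !sumrB; ring.
rewrite /S1 /S2 /S3 -big_split -sumrB /= mulr_sumr -big_split /=.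
apply: eq_bigr => i Ai; rewrite mulrDr mulrDr; congr (_ + _).
  have := sum_qnum_cut (k i); rewrite -/(P i); set S := (\sum_(1 <= r < _) _).
  move=> SE; transitivity ((k i)%:R * ((('X - 1) * S) * P i)); first by ring.
  by rewrite SE; ring.
rewrite -big_split -sumrB /=; congr (_ * _); rewrite mulr_sumr.
by apply: eq_bigr => j Aj; rewrite -/(P2 i j) qnumD; ring.
Qed.

(** * Cycle weights summed over all transpositions *)

Section OrbitWeight.

Variable T : finType.
Implicit Types (s : {perm T}) (x y z : T).

Definition orbitB s : {poly rat} := \prod_(X in porbits s) qnum #|X|.

Lemma mem_porbits s x : porbit s x \in porbits s.
Proof. exact: imset_f. Qed.

Lemma orbitB_cut s x r : (0 < r < #|porbit s x|)%N ->
  orbitB (s * tperm x (iter r s x))%g =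
  qnum r * qnum (#|porbit s x| - r) *
  \prod_(Z in porbits s :\ porbit s x) qnum #|Z|.
Proof.
case/andP => r_gt0 lt_r; set u := (s * _)%g; set y := iter r s x.
rewrite /orbitB (big_setD1 (porbit u x)) ?mem_porbits //=.
rewrite (big_setD1 (porbit u y)) /=; last first.
  by rewrite !inE mem_porbits eq_sym porbit_cut_neq.
by rewrite mulrA card_porbit_cutl // card_porbit_cutr // porbits_cut.
Qed.

Lemma orbitB_join s x y : y \notin porbit s x ->
  orbitB (s * tperm x y)%g = qnum (#|porbit s x| + #|porbit s y|) *
  \prod_(Z in porbits s :\ porbit s x :\ porbit s y) qnum #|Z|.
Proof.
move=> xy; set u := (s * _)%g.
rewrite /orbitB (big_setD1 (porbit u x)) ?mem_porbits //=.
by rewrite card_porbit_join // porbits_join.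
Qed.

Lemma sum_porbit (V : nmodType) s x (F : T -> V) :
  \sum_(y in porbit s x) F y = \sum_(0 <= i < #|porbit s x|) F (iter i s x).
Proof.
rewrite (eq_bigl _ _ (porbit_traject s x)) -big_uniq ?uniq_traject_porbit //=.
rewrite (big_nth x) size_traject !big_nat; apply: eq_bigr => i /andP[_ lt_i].
by rewrite nth_traject.
Qed.

Lemma sum_porbits (V : nmodType) s (A : {set {set T}}) (F : {set T} -> V) :
  A \subset porbits s ->
  \sum_(x | porbit s x \in A) F (porbit s x) = \sum_(X in A) F X *+ #|X|.
Proof.
move=> sA; rewrite (partition_big (porbit s) (mem A)) //=.
apply: eq_bigr => X AX; have /imsetP[z _ defX] := subsetP sA X AX.
rewrite -sumr_const; apply: eq_big => [x|x /andP[_ /eqP->]] //.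
by rewrite andb_idl => [|/eqP->//]; rewrite defX eq_porbit_mem.
Qed.

Lemma sum_card_porbits s :
  (\sum_(X in porbits s) #|X|)%N = #|T|.
Proof.
symmetry; transitivity (\sum_(x | porbit s x \in porbits s) 1)%N.
  by rewrite -sum1_card; apply: eq_bigl => x; rewrite mem_porbits.
etransitivity; first exact: (sum_porbits (fun=> 1%N) (subxx (porbits s))).
by apply: eq_bigr => X _; apply: natn.
Qed.

(** Ordered pairs $(x,y)$ are sorted by the position of $y$: inside the cycle of $x$ it is some
    $s^r(x)$ and the cycle is cut; outside, two cycles are joined. A cycle occurs once for each of
    its points, whence the weights of [cut_join_prod]. *)
Lemma sum_orbitB_tperm s :
  ('X - 1) * (\sum_x \sum_(y | y != x) orbitB (s * tperm x y)%g) =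
  #|T|%:R * (2 * ('X - 1) * ('X * (orbitB s)^`()) - 2 * 'X * orbitB s
             - (#|T|%:R - 1) * ('X - 1) * orbitB s).
Proof.
rewrite -[in RHS](sum_card_porbits s) -(cut_join_prod (porbits s) (fun X => #|X|)).
congr (_ * _).
pose G (X : {set T}) := (\sum_(1 <= r < #|X|) qnum r * qnum (#|X| - r))
   * \prod_(l in porbits s :\ X) qnum #|l|
   + \sum_(Y in porbits s :\ X) #|Y|%:R *
       (qnum (#|X| + #|Y|) * \prod_(l in porbits s :\ X :\ Y) qnum #|l|).
transitivity (\sum_(x | porbit s x \in porbits s) G (porbit s x)); last first.
  by rewrite sum_porbits //; apply: eq_bigr => X _; rewrite mulr_natl.
apply: eq_big => [x|x _]; first by rewrite mem_porbits.
rewrite (bigID (mem (porbit s x))) /=; congr (_ + _).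
  transitivity (\sum_(y in porbit s x :\ x) orbitB (s * tperm x y)%g).
    by apply: eq_bigl => y; rewrite !inE.
  (* The excluded pair $y = x$ is the term $r = 0$; it is added on both sides to sum over the whole
     orbit. *)
  apply: (@addrI _ (orbitB (s * tperm x x)%g)).
  rewrite -(big_setD1 x) ?porbit_id //= (sum_porbit s x (fun y => orbitB (s * tperm x y)%g)).
  rewrite [LHS]big_ltn ?lt0n ?card_porbit_neq0 //=; congr (_ + _).
  rewrite mulr_suml !big_nat; apply: eq_bigr => r lt_r.
  by rewrite orbitB_cut.
have sub : porbits s :\ porbit s x \subset porbits s by apply: subsetDl.
pose H (Y : {set T}) := qnum (#|porbit s x| + #|Y|) *
  \prod_(l in porbits s :\ porbit s x :\ Y) qnum #|l|.
transitivity (\sum_(y | porbit s y \in porbits s :\ porbit s x) H (porbit s y)).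
  apply: eq_big => [y|y /andP[_ xy]]; last by rewrite orbitB_join.
  rewrite !inE mem_porbits andbT eq_porbit_mem andb_idl //.
  by apply: contraNneq => ->; rewrite porbit_id.
by rewrite sum_porbits //; apply: eq_bigr => Y _; rewrite mulr_natl.
Qed.

End OrbitWeight.

(** * Factorizations into a full cycle and transpositions *)

Section OrbitQuotient.

Variables (T : finType) (x0 : T).
Implicit Types (s : {perm T}) (p : {poly rat}).

(** Division by ['X - 1] is avoided: the factor of the cycle through [x0] becomes a geometric
    sum. *)
Definition orbitQ s : {poly rat} :=
  (\sum_(i < #|porbit s x0|) 'X^i) *
  \prod_(Z in porbits s :\ porbit s x0) qnum #|Z|.

Lemma orbitQE s : ('X - 1) * orbitQ s = orbitB s.
Proof.
rewrite /orbitB (big_setD1 (porbit s x0)) ?mem_porbits //=.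
by rewrite mulrA -subrX1.
Qed.

(* Twice the operator [q d/dq - (d-1)/2]. *)
Definition cutjoinD p : {poly rat} := 2 * ('X * p^`()) - (#|T|%:R - 1) * p.

(** Substitute $B = (q-1)Q$: differentiating the factor $q-1$ produces $2q(q-1)Q$, which cancels
    $-2qB$, and $(q-1)^2$ can be divided out. *)
Lemma cutjoinD_orbitQ s :
  #|T|%:R * cutjoinD (orbitQ s) = \sum_x \sum_(y | y != x) orbitQ (s * tperm x y)%g.
Proof.
have nzX : ('X - 1 : {poly rat}) != 0 by rewrite polyXsubC_eq0.
apply: (mulfI nzX); apply: (mulfI nzX).
have -> : ('X - 1) * (\sum_x \sum_(y | y != x) orbitQ (s * tperm x y)%g) =
   \sum_x \sum_(y | y != x) orbitB (s * tperm x y)%g.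
  rewrite mulr_sumr; apply: eq_bigr => x _; rewrite mulr_sumr.
  by apply: eq_bigr => y _; rewrite orbitQE.
rewrite sum_orbitB_tperm -orbitQE derivM derivB derivX derivC subr0 /cutjoinD.
by ring.
Qed.

(** Monomials are eigenvectors, which makes all iterates of the operator explicit. *)
Lemma coef_cutjoinD p j : (cutjoinD p)`_j = (2 * j%:R - (#|T|%:R - 1)) * p`_j.
Proof.
have CE : (#|T|%:R - 1 : {poly rat}) = (#|T|%:R - 1)%:P.
  by rewrite polyCB polyC_natr.
rewrite /cutjoinD CE coefB coefCM mulr_natl coefMn coefXM mulrBl.
case: j => [|j]; first by rewrite eqxx mulr0n mul0rn; ring.
by rewrite /= coef_deriv -mulr_natl; ring.
Qed.

Lemma coef_iter_cutjoinD t p j :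
  (iter t cutjoinD p)`_j = (2 * j%:R - (#|T|%:R - 1)) ^+ t * p`_j.
Proof. by elim: t => [|t IH] /=; rewrite ?mul1r // coef_cutjoinD IH mulrA exprS. Qed.

Lemma iter_cutjoinD_natr t n p : iter t cutjoinD (n%:R * p) = n%:R * iter t cutjoinD p.
Proof.
apply/polyP => j; rewrite coef_iter_cutjoinD -!polyC_natr !coefCM coef_iter_cutjoinD.
exact: mulrCA.
Qed.

Lemma iter_cutjoinD_sum t (I : finType) (P : pred I) (F : I -> {poly rat}) :
  iter t cutjoinD (\sum_(i | P i) F i) = \sum_(i | P i) iter t cutjoinD (F i).
Proof.
apply/polyP => j; rewrite coef_iter_cutjoinD !coef_sum mulr_sumr.
by apply: eq_bigr => i _; rewrite coef_iter_cutjoinD.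
Qed.

End OrbitQuotient.

Section Transpositions.

Variable T : finType.

Definition is_transp (t : {perm T}) : bool :=
  [exists y : T * T, (y.1 != y.2) && (t == tperm y.1 y.2)].

Lemma tperm_eqP (a b x y : T) : a != b ->
  (x != y) && (tperm x y == tperm a b) = ((x, y) \in [set (a, b); (b, a)]).
Proof.
move=> ab; rewrite !inE !xpair_eqE; apply/idP/idP.
  case/andP => xy /eqP e.
  have ex := congr1 (fun s : {perm T} => s x) e.
  rewrite /= tpermL in ex; move: ex xy.
  by case: tpermP => [->|->|_ _] ->; rewrite ?eqxx ?orbT.
case/orP => /andP[/eqP-> /eqP->]; first by rewrite ab eqxx.
by rewrite eq_sym ab tpermC eqxx.
Qed.

Lemma sum_is_transp (V : nmodType) (F : {perm T} -> V) :
  \sum_x \sum_(y | y != x) F (tperm x y) = (\sum_(t | is_transp t) F t) *+ 2.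
Proof.
rewrite pair_big_dep /=.
rewrite (partition_big (fun p : T * T => tperm p.1 p.2) is_transp) /=; last first.
  by move=> [a b] /= ab; apply/existsP; exists (a, b); rewrite /= eq_sym ab eqxx.
rewrite -sumrMnl; apply: eq_bigr => t /existsP[[a b] /= /andP[ab /eqP defT]].
rewrite defT (eq_bigl (fun p => p \in [set (a, b); (b, a)])); last first.
  by move=> [x y] /=; rewrite eq_sym tperm_eqP.
rewrite (eq_bigr (fun=> F (tperm a b))); last first.
  by move=> [x y]; rewrite -tperm_eqP // => /andP[_ /eqP->].
by rewrite sumr_const cards2 xpair_eqE (negPf ab).
Qed.

End Transpositions.

Lemma sum_ffun_recr (V : nmodType) (J : finType) t (F : {ffun 'I_t.+1 -> J} -> V) :
  \sum_f F f = \sum_j \sum_(f : {ffun 'I_t -> J})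
    F [ffun i => if unlift ord_max i is Some k then f k else j].
Proof.
rewrite pair_big /=; symmetry.
pose h (p : J * {ffun 'I_t -> J}) : {ffun 'I_t.+1 -> J} :=
  [ffun i => if unlift ord_max i is Some k then p.2 k else p.1].
pose h' (f : {ffun 'I_t.+1 -> J}) := (f ord_max, [ffun k => f (lift ord_max k)]).
have hK : cancel h h'.
  move=> [j f]; rewrite /h' /h !ffunE unlift_none; congr (_, _).
  by apply/ffunP => k; rewrite !ffunE liftK.
have hK' : cancel h' h.
  move=> f; apply/ffunP => i; rewrite !ffunE /=.
  by case: unliftP => [k ->|->]; rewrite ?ffunE.
by rewrite (reindex h) //; apply: onW_bij; exists h'.
Qed.

Section Counting.

Variable d : nat.
Implicit Types (s : {perm 'I_d}).

Definition full_cycle s : bool := has_cycle_type s [:: d].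

(** The full cycle is determined by [s] and the transpositions, so the sum runs over the latter
    only. *)
Definition nfactor t s : nat :=
  \sum_(f : {ffun 'I_t -> {perm 'I_d}} | [forall i, is_transp (f i)])
    full_cycle (s * (\prod_(i < t) f i)^-1)%g.

Lemma nfactor0 s : nfactor 0 s = full_cycle s.
Proof.
rewrite /nfactor (big_pred1 [ffun=> 1%g]) /=.
  by rewrite big_ord0 invg1 mulg1.
move=> f; rewrite (_ : f = [ffun=> 1%g]); last by apply/ffunP => -[].
by rewrite /= eqxx; apply/forallP => -[].
Qed.

(** If $u$ is the last transposition and $p$ the product of the others, then $s(pu)^{-1} =
    (su)p^{-1}$, since $u$ is an involution. *)
Lemma nfactorS t s : nfactor t.+1 s = \sum_(u | is_transp u) nfactor t (s * u)%g.
Proof.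
rewrite /nfactor big_mkcond /= sum_ffun_recr [RHS]big_mkcond /=.
apply: eq_bigr => u _; case: ifP => tu.
  rewrite [RHS]big_mkcond; apply: eq_bigr => f _.
  rewrite big_ord_recr /= ffunE unlift_none.
  have -> : (\prod_(i < t) [ffun i => if unlift ord_max i is Some k then f k else u]
               (widen_ord (leqnSn t) i) = \prod_(i < t) f i)%g.
    apply: eq_bigr => i _; rewrite ffunE.
    have -> : widen_ord (leqnSn t) i = lift ord_max i.
      by apply/val_inj; rewrite /= /bump leqNgt ltn_ord.
    by rewrite liftK.
  have [[a b] /= /andP[_ /eqP defu]] := existsP tu.
  rewrite invMg mulgA -[(u^-1)%g](_ : u = _); last by rewrite defu tpermV.
  congr (if _ then _ else _); apply/forallP/forallP => tf i.
    by have := tf (lift ord_max i); rewrite ffunE liftK.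
  by rewrite ffunE; case: unliftP.
rewrite big1 // => f _; case: ifP => // /forallP/(_ ord_max).
by rewrite ffunE unlift_none tu.
Qed.

(** The product relation determines $\sigma_0$ from the other entries; what is left is a
    factorization of $\sigma_{t+1}^{-1}$. *)
Lemma hurwitz_countE t beta :
  hurwitz_count d t beta = \sum_(s | has_cycle_type s beta) nfactor t (s^-1)%g.
Proof.
rewrite /hurwitz_count /nfactor pair_big_dep /= -big_mkcondr /= -sum1_card.
pose h (p : {perm 'I_d} * {ffun 'I_t -> {perm 'I_d}}) :=
  (((p.1^-1 * (\prod_(i < t) p.2 i)^-1)%g, p.2), p.1).
pose h' (x : {perm 'I_d} * {ffun 'I_t -> {perm 'I_d}} * {perm 'I_d}) :=
  (x.2, x.1.2).
rewrite (reindex_onto h h'); last first.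
  move=> [[a f] b] /=; rewrite !inE /= => /and4P[_ _ _ /eqP e].
  congr (_, _, _); apply: (mulIg (\prod_(i < t) f i)%g); apply: (mulIg b).
  by rewrite e mulgKV mulVg.
apply: eq_bigl => -[s f] /=; rewrite !inE /= eqxx andbT.
rewrite mulgKV mulVg !eqxx !andbT -/(full_cycle _).
by case: (full_cycle _); rewrite ?andbF // andbT /= andbC.
Qed.

Lemma full_cycleE (x0 : 'I_d) s : full_cycle s = (porbits s :\ porbit s x0 == set0).
Proof.
rewrite setD_eq0 /full_cycle /has_cycle_type /cycle_type_seq; apply/idP/idP.
  move=> /perm_size; rewrite size_map -cardE => /eqP/cards1P[X eX].
  by have := mem_porbits s x0; rewrite eX inE => /eqP->.
move=> sub; have eX : porbits s = [set porbit s x0].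
  by apply/eqP; rewrite eqEsubset sub sub1set mem_porbits.
have := sum_card_porbits s; rewrite eX big_set1 card_ord => e.
by rewrite /image_mem enum_set1 /= e.
Qed.

(** A second cycle contributes a factor $q^k - 1$, zero at $q = 1$; for a single cycle only a
    geometric sum of [d] terms remains. *)
Lemma orbitQ_eval1 (x0 : 'I_d) s : (orbitQ x0 s).[1] = d%:R * (full_cycle s)%:R.
Proof.
have sum1 k : (\sum_(i < k) 'X^i).[1] = k%:R :> rat.
  rewrite horner_sum (eq_bigr (fun=> 1)) => [|i _]; last by rewrite hornerXn expr1n.
  by rewrite sumr_const card_ord.
rewrite (full_cycleE x0) /orbitQ hornerM sum1 horner_prod.
have [e|[Z Zin]] := set_0Vmem (porbits s :\ porbit s x0).
  have := sum_card_porbits s; rewrite (big_setD1 _ (mem_porbits s x0)) /=.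
  by rewrite e !big_set0 addn0 card_ord eqxx => ->.
rewrite [X in _ * X](bigD1 Z) //= /qnum hornerD hornerN hornerC hornerXn expr1n.
rewrite subrr mul0r !mulr0.
by case: eqP => [e|]; rewrite ?mulr0 //; rewrite e inE in Zin.
Qed.

(** The cut-and-join equation trades the sum over the last transposition for one application of
    [cutjoinD]. The powers of 2 appear because each transposition comes from two ordered pairs. *)
Lemma nfactor_iter (x0 : 'I_d) t s :
  d%:R * 2 ^+ t * (nfactor t s)%:R =
  d%:R ^+ t * (iter t (@cutjoinD 'I_d) (orbitQ x0 s)).[1] :> rat.
Proof.
elim: t s => [|t IH] s; first by rewrite nfactor0 !mulr1 mul1r /= orbitQ_eval1.
have /(congr1 (iter t (@cutjoinD 'I_d))) := cutjoinD_orbitQ x0 s.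
rewrite (sum_is_transp (fun u => orbitQ x0 (s * u)%g)) card_ord.
rewrite -[_ *+ 2]mulr_natl !iter_cutjoinD_natr iter_cutjoinD_sum.
move/(congr1 (fun p : {poly rat} => p.[1])).
rewrite !hornerM -!polyC_natr !hornerC horner_sum -iterSr => e.
rewrite nfactorS natr_sum exprS [X in _ = X * _]exprSr -[RHS]mulrA e.
rewrite [RHS]mulrCA mulr_sumr [X in _ = _ * X]mulr_sumr.
rewrite mulr_sumr; apply: eq_bigr => u _.
by rewrite -IH; ring.
Qed.

(** Halving the eigenvalues absorbs the power of 2. The sum is the [t]-th derivative at $z = 0$ of
    $q^{-(d-1)/2}Q$ with $q = e^z$. *)
Lemma nfactor_coef (x0 : 'I_d) t s N : (size (orbitQ x0 s) <= N)%N ->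
  d%:R * (nfactor t s)%:R =
  d%:R ^+ t * \sum_(j < N) (orbitQ x0 s)`_j * (j%:R - (d%:R - 1) / 2) ^+ t :> rat.
Proof.
move=> leN; apply: (mulfI (x := 2 ^+ t)); first by rewrite expf_neq0.
rewrite mulrA [2 ^+ t * _]mulrC (nfactor_iter x0) mulrCA; congr (_ * _).
rewrite (@horner_coef_wide _ N) => [|].
  rewrite mulr_sumr; apply: eq_bigr => j _.
  rewrite coef_iter_cutjoinD expr1n card_ord mulr1 mulrC mulrCA; congr (_ * _).
  by rewrite -exprMn; congr (_ ^+ _); field.
apply/leq_sizeP => j le_j; rewrite coef_iter_cutjoinD.
by rewrite (leq_sizeP _ _ leN) ?mulr0.
Qed.

End Counting.

(** * Sizes of conjugacy classes *)

Section Labelled.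

Variable T : finType.
Implicit Types (s u : {perm T}) (x y z : T) (b : seq nat) (r : seq T).

(** One point is marked in each of several distinct cycles; the marks make the joining of two cycles
    reversible. *)
Definition marked s r b : bool :=
  ([seq #|porbit s x| | x <- r] == b) && uniq [seq porbit s x | x <- r].

Lemma marked_cons s x r (k : nat) b : marked s (x :: r) (k :: b) =
  [&& #|porbit s x| == k, porbit s x \notin [seq porbit s z | z <- r]
    & marked s r b].
Proof.
rewrite /marked /= eqseq_cons; do 2!case: (_ == _) => //=.
by rewrite andbF.
Qed.

Lemma porbit_notin_map s x r :
  porbit s x \notin [seq porbit s z | z <- r] ->
  {in r, forall z, z \notin porbit s x}.
Proof.
move=> xr z rz; apply: contra xr => zx.
by rewrite -(eq_porbit zx) map_f.
Qed.

Lemma eq_marked s u r b : {in r, porbit s =1 porbit u} ->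
  marked s r b = marked u r b.
Proof.
move=> e; rewrite /marked ((eq_in_map _ _ _).1 e); congr (_ && _); congr (_ == _).
by apply/eq_in_map => z rz; rewrite e.
Qed.

Lemma marked_join s x1 x2 r (b1 b2 : nat) b (u := (s * tperm x1 x2)%g) :
  marked s (x1 :: x2 :: r) (b1 :: b2 :: b) ->
  marked u (x1 :: r) ((b1 + b2)%N :: b) /\ iter b1 u x1 = x2.
Proof.
rewrite !marked_cons /= inE negb_or => /and5P[/eqP e1 /andP[n12 n1] /eqP e2 n2 mr].
have x21 : x2 \notin porbit s x1 by rewrite -eq_porbit_mem eq_sym.
have out : {in r, porbit u =1 porbit s}.
  move=> z rz; apply: porbit_mul_tperm_out; rewrite porbit_sym.
    exact: porbit_notin_map rz.
  exact: porbit_notin_map rz.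
split; last by rewrite -e1 iter_join.
rewrite card_porbit_join // e1 e2 eqxx (eq_marked _ out) mr andbT /=.
apply/mapP => -[z rz]; rewrite (out z rz) => e.
have := porbit_notin_map n1 rz; rewrite porbit_sym -e porbit_id //.
Qed.

Lemma marked_cut u x r (b1 b2 : nat) b (y := iter b1 u x) :
  (0 < b1)%N -> (0 < b2)%N -> marked u (x :: r) ((b1 + b2)%N :: b) ->
  marked (u * tperm x y)%g (x :: y :: r) (b1 :: b2 :: b).
Proof.
move=> b1_gt0 b2_gt0; rewrite !marked_cons => /and3P[/eqP e n1 mr].
have lt_b1 : (b1 < #|porbit u x|)%N by rewrite e; lia.
have out : {in r, porbit (u * tperm x y)%g =1 porbit u}.
  by move=> z rz; apply: porbit_cut_out; apply: porbit_notin_map rz.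
rewrite card_porbit_cutl // card_porbit_cutr // e addKn !eqxx /=.
rewrite inE negb_or porbit_cut_neq // (eq_marked _ out) mr !andbT /=.
rewrite ((eq_in_map _ _ _).1 out); apply/andP; split; apply/mapP => -[z rz ez].
  by have := porbit_notin_map n1 rz; rewrite porbit_sym -ez porbit_id.
have := porbit_notin_map n1 rz.
by rewrite -(eq_porbit (mem_porbit_iter u x b1)) porbit_sym -ez porbit_id.
Qed.

Definition labelled n b : {set {perm T} * n.-tuple T} :=
  [set p : {perm T} * n.-tuple T | marked p.1 p.2 b].

(** The bijection joins the first two marked cycles by the transposition of their marks and forgets
    the second mark. That mark is recovered as the point [b1] steps after the first, where the
    inverse map cuts. *)
Lemma labelled_merge n (b1 b2 : nat) b : (0 < b1)%N -> (0 < b2)%N ->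
  #|labelled n.+2 (b1 :: b2 :: b)| = #|labelled n.+1 ((b1 + b2)%N :: b)|.
Proof.
move=> b1_gt0 b2_gt0.
pose f (p : {perm T} * n.+2.-tuple T) : {perm T} * n.+1.-tuple T :=
  ((p.1 * tperm (thead p.2) (thead [tuple of behead p.2]))%g,
   [tuple of thead p.2 :: behead (behead p.2)]).
have fE s x1 x2 (t : n.-tuple T) :
    f (s, [tuple of x1 :: [tuple of x2 :: t]]) =
    ((s * tperm x1 x2)%g, [tuple of x1 :: t]).
  by congr (_, _); apply/val_inj.
have inj_f : {in labelled n.+2 (b1 :: b2 :: b) &, injective f}.
  move=> [s t] [s' t']; case/tupleP: t => x1 t; case/tupleP: t => x2 t.
  case/tupleP: t' => y1 t'; case/tupleP: t' => y2 t'.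
  rewrite !inE /= => /marked_join[_ i1] /marked_join[_ i2].
  rewrite !fE => -[eu ex et]; rewrite -{y1}ex in i2 eu *.
  have e2 : x2 = y2 by rewrite -i1 -i2 eu.
  rewrite -{y2 i2}e2 in eu *; congr (_, _); first exact: mulIg eu.
  by apply/val_inj; rewrite /= et.
rewrite -(card_in_imset inj_f); apply: eq_card => p; apply/imsetP/idP.
  move=> [[s t] + ->]; case/tupleP: t => x1 t; case/tupleP: t => x2 t.
  by rewrite fE !inE => /marked_join[].
case: p => u t; case/tupleP: t => x t; rewrite inE => mu.
pose y := iter b1 u x.
exists ((u * tperm x y)%g, [tuple of x :: [tuple of y :: t]]).
  by rewrite inE; apply: marked_cut.
by rewrite fE -mulgA tperm2 mulg1.
Qed.

Lemma card_labelled_sum n b : size b = n -> (0 < n)%N -> all (ltn 0) b ->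
  #|labelled n b| = #|labelled 1 [:: sumn b]|.
Proof.
case: n => // n + _; elim: n b => [|n IH] [|b1 b] //=.
  by case: b => //= _; rewrite addn0.
case: b => [|b2 b] //= -[sz] /and3P[b1_gt0 b2_gt0 b_gt0].
by rewrite labelled_merge // IH /= ?sz ?addnA ?b_gt0 ?andbT //; lia.
Qed.

(** The marked fixed points exhaust [T], so the permutation is the identity and the marks form an
    arbitrary ordering of [T]. *)
Lemma card_labelled1 : #|labelled #|T| (nseq #|T| 1%N)| = (#|T|)`!.
Proof.
have <- : #|[set t : #|T|.-tuple T | all predT t & uniq t]| = (#|T|)`!.
  by rewrite card_uniq_tuples ffactnn.
rewrite -(card_imset (f := fun t : #|T|.-tuple T => (1%g : {perm T}, t))); last first.
  by move=> t t' [].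
have p1 x : porbit (1%g : {perm T}) x = [set x].
  by apply/setP => y; apply/porbitP/set1P => [[i ->]|->];
     [rewrite expg1n perm1 | exists 0; rewrite expg0 perm1].
apply: eq_card => -[s t]; rewrite inE; apply/idP/imsetP => [|[t' + [-> ->]]].
  case/andP => /eqP sz Ut; exists t.
    by rewrite inE all_predT (map_uniq Ut).
  congr (_, _); apply/permP => x; rewrite perm1.
  have tx : x \in t.
    have /subset_cardP/(_ (subset_predT _))-> // : #|t| = #|T|.
    by rewrite (card_uniqP (map_uniq Ut)) size_tuple.
  have : #|porbit s x| \in nseq #|T| 1%N by rewrite -sz (map_f (fun z => #|porbit s z|)).
  rewrite mem_nseq => /andP[_ /cards1P[z e]].
  have /set1P-> : s x \in [set z] by rewrite -e (mem_porbit s 1).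
  by have /set1P-> : x \in [set z] by rewrite -e porbit_id.
rewrite inE all_predT => /= Ut; rewrite /marked /= (eq_map p1) map_inj_uniq ?Ut ?andbT //; last exact: set1_inj.
have := all_pred1P 1%N [seq #|porbit (1%g : {perm T}) x| | x <- t'].
rewrite size_map size_tuple => /elimT-> //.
by apply/allP => _ /mapP[x _ ->]; rewrite /= p1 cards1.
Qed.

(** Repeated merging reduces both [b] and the all-ones list to the same one-part list. *)
Lemma card_labelled n b : size b = n -> (0 < n)%N -> all (ltn 0) b ->
  sumn b = #|T| -> #|labelled n b| = (#|T|)`!.
Proof.
move=> sz n_gt0 b_gt0 sb; rewrite (card_labelled_sum sz) // -card_labelled1.
have T_gt0 : (0 < #|T|)%N.
  by rewrite -sb; case: b b_gt0 sz n_gt0 {sb} => [|a b] /= => [_ <-|/andP[]] //; lia.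
rewrite sb [RHS]card_labelled_sum ?size_nseq ?all_nseq ?orbT //.
by rewrite sumn_nseq mul1n.
Qed.

Lemma sum_tuple_cons (V : nmodType) n (F : n.+1.-tuple T -> V) :
  \sum_t F t = \sum_x \sum_(t : n.-tuple T) F [tuple of x :: t].
Proof.
rewrite pair_big /=.
rewrite (reindex (fun p : T * n.-tuple T => [tuple of p.1 :: p.2])) //=.
exists (fun t => (thead t, [tuple of behead t])) => [[x t]|t] _ /=.
  by congr (_, _); apply/val_inj.
by case/tupleP: t => x t; apply/val_inj.
Qed.

Lemma prod_count_cons m k b : (k <= m)%N ->
  (\prod_(i < m.+1) (count_mem (i : nat) (k :: b))`! =
   (count_mem k (k :: b)) * \prod_(i < m.+1) (count_mem (i : nat) b)`!)%N.
Proof.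
move=> le_k; pose k' : 'I_m.+1 := Ordinal (le_k : (k < m.+1)%N).
rewrite (bigD1 k') //= [in RHS](bigD1 k') //= eqxx add1n factS mulnA.
congr (_ * _)%N; apply: eq_bigr => i ik; congr (_`!).
rewrite (_ : (k == i :> nat) = false) //.
by apply: contraNF ik => /eqP e; apply/eqP/val_inj.
Qed.

(** Parts are matched with cycles of equal length, in as many ways as the product of the factorials
    of the multiplicities, and a point is chosen in each cycle. The induction removes the cycle just
    marked, hence the general set [A] of cycles. *)
Lemma card_marked s (A : {set {set T}}) b m :
  A \subset porbits s -> perm_eq [seq #|X| | X : {set T} in A] b ->
  all (fun k => k <= m)%N b ->
  (\sum_(t : (size b).-tuple T)
     (marked s t b && all (fun x => porbit s x \in A) t) =
   \prod_(k <- b) k * \prod_(i < m.+1) (count_mem (i : nat) b)`!)%N.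
Proof.
elim: b A => [|k b IH] A sA pA.
  move=> _ /=; rewrite big_nil (big_pred1 [tuple]) /=; last by move=> t; apply/esym/eqP; apply: tuple0.
  by rewrite big1.
case/andP => le_k le_b; rewrite big_cons prod_count_cons // mulnACA.
set c := (\prod_(k <- b) k * _)%N in IH *.
rewrite sum_tuple_cons.
pose Ak := [set X in A | #|X| == k].
have cardAk : #|Ak| = count_mem k (k :: b).
  rewrite -(seq.permP pA) count_map -size_filter cardE.
  apply/perm_size/uniq_perm => [||X]; [exact: enum_uniq | |].
    by apply: filter_uniq; apply: enum_uniq.
  by rewrite mem_enum [RHS]mem_filter mem_enum inE andbC.
transitivity (\sum_(x | porbit s x \in Ak) c)%N.
  rewrite [RHS]big_mkcond; apply: eq_bigr => x _; rewrite inE /=.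
  have [/andP[xA /eqP xk]|nx] := ifP; last first.
    rewrite big1 // => t _; rewrite marked_cons.
    by move: nx; case: (porbit s x \in A) => //= [->|_] //; rewrite andbF.
  rewrite -(IH (A :\ porbit s x)) //; first 1 last.
  - exact: subset_trans (subsetDl _ _) sA.
  - rewrite -(perm_cons k) -(permPr pA) -{1}xk perm_sym.
    suff pe : perm_eq (enum A) (porbit s x :: enum (A :\ porbit s x)).
      exact: (perm_map (fun X : {set T} => #|X|) pe).
    apply: uniq_perm => [||X]; first exact: enum_uniq.
      by rewrite cons_uniq enum_uniq mem_enum !inE eqxx.
    rewrite inE !mem_enum !inE; case: eqP => // ->; exact: xA.
  apply: eq_bigr => t _; rewrite marked_cons xA xk eqxx /=; congr (nat_of_bool _).
  rewrite andbAC andbC; case: (marked _ _ _) => //=.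
  rewrite -has_pred1 has_map -all_predC -all_predI; apply: eq_all => z /=.
  by rewrite !inE.
have sAk : Ak \subset porbits s.
  by apply: subset_trans sA; apply/subsetP => X; rewrite inE => /andP[].
etransitivity; first exact: (sum_porbits (fun=> c) sAk).
rewrite (eq_bigr (fun=> k * c)%N) => [|X]; last first.
  by rewrite inE => /andP[_ /eqP->]; rewrite -[LHS]mulr_natr natn mulnC.
by rewrite [LHS]big_const iter_addn_0 cardAk mulnCA mulnC -mulnA; lia.
Qed.

End Labelled.

(** The marked cycles already cover [d] points, so no other cycle exists. *)
Lemma marked_cycle_type d (s : {perm 'I_d}) (t : seq 'I_d) b :
  sumn b = d -> marked s t b -> has_cycle_type s b.
Proof.
move=> sb /andP[/eqP eb Ut]; pose r := [seq porbit s x | x <- t].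
have sub : {subset r <= porbits s} by move=> _ /mapP[x _ ->]; apply: mem_porbits.
suff pe : perm_eq (enum (porbits s)) r.
  rewrite /has_cycle_type -eb; have := perm_map (fun X : {set 'I_d} => #|X|) pe.
  by rewrite -map_comp.
apply: uniq_perm => [||X]; [exact: enum_uniq | exact: Ut | rewrite mem_enum].
apply/idP/idP => [sX|]; last exact: sub.
have := sum_card_porbits s; rewrite (bigID (fun Z => Z \in r)) /=.
rewrite (eq_bigl (mem r)) => [|Z]; last by rewrite andb_idl //; apply: sub.
rewrite -big_uniq //= /r big_map -(big_map (fun x => #|porbit s x|) xpredT id) eb.
rewrite -sumnE sb card_ord => /eqP; rewrite -[X in _ == X]addn0 eqn_add2l.
rewrite sum_nat_eq0 => /forallP/(_ X); rewrite sX /=; apply: contraTT => ->.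
by case/imsetP: sX => x _ ->; rewrite card_porbit_neq0.
Qed.

(** Pairs of a permutation and a marking are counted in two ways, by [card_labelled] and by
    [card_marked]. *)
Lemma card_cycle_type d b : (0 < size b)%N -> all (ltn 0) b -> sumn b = d ->
  (#|[set s : {perm 'I_d} | has_cycle_type s b]| *
     (\prod_(k <- b) k * aut_part d b) = d`!)%N.
Proof.
move=> sz b_gt0 sb.
have <- : #|@labelled 'I_d (size b) b| = d`!.
  by rewrite (@card_labelled _ (size b)) ?card_ord.
rewrite -[in RHS]sum1dep_card.
rewrite -(pair_big_dep xpredT (fun s (t : (size b).-tuple 'I_d) => marked s t b) (fun _ _ => 1%N)) /=.
rewrite [RHS](bigID (fun s => has_cycle_type s b)) /= [X in (_ + X)%N]big1 ?addn0; last first.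
  by move=> s ns; apply: big_pred0 => t; apply: contraNF ns; apply: marked_cycle_type.
rewrite -sum_nat_const; apply: eq_big => [s|s]; first by rewrite inE.
rewrite inE => st; rewrite -(@card_marked _ s (porbits s)) //; last first.
  apply/allP => k bk; rewrite -sb; elim: b bk {sz b_gt0 sb st} => //= a b IH.
  by rewrite inE => /predU1P[->|/IH]; lia.
rewrite [RHS]big_mkcond /=; apply: eq_bigr => t _.
rewrite (_ : all _ _) ?andbT; first by case: (marked s t b).
by apply/allP => x _; apply: mem_porbits.
Qed.

(** * Truncated power series *)

(* Congruence modulo ['X^N], i.e. equality of power series up to order [N]. *)
Definition eqX (R : nzRingType) (N : nat) (p q : {poly R}) : Prop :=
  forall i, (i < N)%N -> p`_i = q`_i.

Section EqX.

Variables (R : comNzRingType) (N : nat).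
Implicit Types p q : {poly R}.

Lemma eqX_refl p : eqX N p p. Proof. by []. Qed.

Lemma eqX_sym p q : eqX N p q -> eqX N q p.
Proof. by move=> e i /e. Qed.

Lemma eqX_trans q p r : eqX N p q -> eqX N q r -> eqX N p r.
Proof. by move=> e1 e2 i lt_i; rewrite e1 ?e2. Qed.

Lemma eqX_add p q p' q' : eqX N p q -> eqX N p' q' -> eqX N (p + p') (q + q').
Proof. by move=> e1 e2 i lt_i; rewrite !coefD e1 ?e2. Qed.

Lemma eqX_mul p q p' q' : eqX N p q -> eqX N p' q' -> eqX N (p * p') (q * q').
Proof.
move=> e1 e2 i lt_i; rewrite !coefM; apply: eq_bigr => j _.
by rewrite e1 ?e2 //; have := ltn_ord j; lia.
Qed.

Lemma eqX_prod (I : Type) (r : seq I) (F G : I -> {poly R}) :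
  (forall i, eqX N (F i) (G i)) -> eqX N (\prod_(i <- r) F i) (\prod_(i <- r) G i).
Proof. by move=> e; apply: (big_ind2 (eqX N)) => //; apply: eqX_mul. Qed.

(** Congruences are derived as linear combinations of known ones: once the multipliers are given,
    [ring] checks the remaining equality. *)
Lemma eqX_lin1 a b c p q : eqX N p q -> a - b = c * (p - q) -> eqX N a b.
Proof.
move=> e eab; have {eab} -> : a = b + c * (p - q) by rewrite -eab addrC subrK.
rewrite -[X in eqX N _ X]addr0; apply: eqX_add => //.
rewrite -(mulr0 c); apply: eqX_mul => // i lt_i.
by rewrite coefB e // subrr coef0.
Qed.

Lemma eqX_lin2 a b c1 p1 q1 c2 p2 q2 : eqX N p1 q1 -> eqX N p2 q2 ->
  a - b = c1 * (p1 - q1) + c2 * (p2 - q2) -> eqX N a b.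
Proof.
move=> e1 e2 eab; apply: (@eqX_trans (b + c1 * (p1 - q1))).
  by apply: (eqX_lin1 e2 (c := c2)); rewrite opprD addrA eab addrAC subrr add0r.
by apply: (eqX_lin1 e1 (c := c1)); rewrite addrAC subrr add0r.
Qed.

Lemma eqX_lin3 a b c1 p1 q1 c2 p2 q2 c3 p3 q3 :
  eqX N p1 q1 -> eqX N p2 q2 -> eqX N p3 q3 ->
  a - b = c1 * (p1 - q1) + c2 * (p2 - q2) + c3 * (p3 - q3) -> eqX N a b.
Proof.
move=> e1 e2 e3 eab; apply: (@eqX_trans (b + c1 * (p1 - q1))).
  apply: (eqX_lin2 e2 e3 (c1 := c2) (c2 := c3)).
  by rewrite opprD addrA eab; ring.
by apply: (eqX_lin1 e1 (c := c1)); rewrite addrAC subrr add0r.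
Qed.

(** The operator $z\,d/dz$ preserves the truncation order, whereas $d/dz$ alone would lower it. *)
Lemma eqX_theta p q : eqX N p q -> eqX N ('X * p^`()) ('X * q^`()).
Proof.
move=> e [|i] lt_i; rewrite !coefXM //= !coef_deriv; congr (_ *+ _); exact: e.
Qed.

End EqX.

Lemma eqX_leq (R : nzRingType) M N (p q : {poly R}) :
  (M <= N)%N -> eqX N p q -> eqX M p q.
Proof. by move=> le_MN e i lt_i; apply: e; apply: leq_trans lt_i le_MN. Qed.

Lemma eqX_cancelX (R : nzRingType) N (p q : {poly R}) :
  eqX N ('X * p) ('X * q) -> eqX N.-1 p q.
Proof. by move=> e i lt_i; have := e i.+1; rewrite !coefXM /=; apply; lia. Qed.

Section ExpSeries.

Variables (R : comNzRingType) (io : {rmorphism rat -> R}) (N : nat).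
Implicit Types a b : R.

(** This truncates $e^{az}$. The coefficient ring is general because [a] will be a rational number
    or a multiple of a second variable $w$. *)
Definition expX a : {poly R} := \poly_(i < N) (io (i`!%:R^-1) * a ^+ i).

Lemma coef_expX a i : (i < N)%N -> (expX a)`_i = io (i`!%:R^-1) * a ^+ i.
Proof. by move=> lt_i; rewrite coef_poly lt_i. Qed.

Lemma factq_neq0 n : n`!%:R != 0 :> rat.
Proof. by rewrite pnatr_eq0 -lt0n fact_gt0. Qed.

Lemma expX_add a b : eqX N (expX a * expX b) (expX (a + b)).
Proof.
move=> m lt_m; rewrite coef_expX // coefM exprDn mulr_sumr.
rewrite (reindex_inj rev_ord_inj) /=; apply: eq_bigr => j _; rewrite subSS.
have le_j : (j <= m)%N by rewrite -ltnS.
rewrite subKn // !coef_expX; [|lia..].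
have e : (m - j)`!%:R^-1 / j`!%:R = m`!%:R^-1 * 'C(m, j)%:R :> rat.
  rewrite -(bin_fact le_j) !natrM; field.
  by rewrite !factq_neq0 pnatr_eq0 -lt0n bin_gt0 le_j.
by rewrite mulrACA -rmorphM e rmorphM rmorph_nat; ring.
Qed.

Lemma expX_0 : eqX N (expX 0) 1.
Proof.
move=> i lt_i; rewrite coef_expX // coefC expr0n; case: eqP => [->|_].
  by rewrite fact0 invr1 rmorph1 mulr1.
by rewrite mulr0.
Qed.

Lemma expX_natM a k : eqX N (expX a ^+ k) (expX (k%:R * a)).
Proof.
elim: k => [|k IH]; first by rewrite mul0r; apply: eqX_sym expX_0.
rewrite exprS -natr1 mulrDl mul1r addrC.
by apply: eqX_trans (expX_add _ _); apply: eqX_mul.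
Qed.

Lemma expX_sum (I : Type) (r : seq I) (F : I -> R) :
  eqX N (\prod_(i <- r) expX (F i)) (expX (\sum_(i <- r) F i)).
Proof.
elim: r => [|i r IH]; first by rewrite !big_nil; apply: eqX_sym expX_0.
by rewrite !big_cons; apply: eqX_trans (expX_add _ _); apply: eqX_mul.
Qed.

Lemma theta_expX a : eqX N ('X * (expX a)^`()) (a%:P * 'X * expX a).
Proof.
move=> i lt_i; rewrite -mulrA coefCM !coefXM; case: i lt_i => [|i] lt_i /=.
  by rewrite mulr0.
rewrite coef_deriv !coef_expX ?(ltnW lt_i) // factS natrM exprS.
rewrite -mulrnAl -[_ *+ _]mulr_natr -(rmorph_nat io) -rmorphM mulrCA; congr (_ * (io _ * _)).
by rewrite invfM mulrAC mulVf ?mul1r // pnatr_eq0.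
Qed.

End ExpSeries.

(** * Bernoulli numbers and hyperbolic series *)

Lemma size_bern_seq m : size (bern_seq m) = m.+1.
Proof. by elim: m => //= m IH; rewrite size_rcons IH. Qed.

Lemma nth_bern_seq m j : (j <= m)%N -> (bern_seq m)`_j = bernoulli j.
Proof.
elim: m => [|m IH]; first by rewrite leqn0 => /eqP->.
rewrite leq_eqVlt => /predU1P[->//|lt_j] /=.
by rewrite nth_rcons size_bern_seq lt_j IH.
Qed.

Lemma bernoulliS m : bernoulli m.+1 = - (m.+1)`!%:R *
  \sum_(j < m.+1) bernoulli j / (j`!%:R * (m.+2 - j)`!%:R).
Proof.
rewrite /bernoulli /= nth_rcons size_bern_seq ltnn eqxx; congr (_ * _).
by apply: eq_bigr => j _; rewrite nth_bern_seq // -ltnS.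
Qed.

Section Series.

Variable N : nat.

Notation ex := (@expX rat idfun N).

(* Truncations of [z/(e^z - 1)], [(e^z - 1)/z], [sinh(a z/2)/(a z/2)] and, for
   [cscX], of [(z/2)/sinh(z/2)]. *)
Definition bernX : {poly rat} := \poly_(r < N) (bernoulli r / r`!%:R).

Definition texpX : {poly rat} := \poly_(i < N) ((i.+1)`!%:R^-1).

Definition sinhcX (a : rat) : {poly rat} :=
  \poly_(i < N) (if odd i then 0 else a ^+ i / (2 ^+ i * (i.+1)`!%:R)).

Definition cscX : {poly rat} := bernX * ex (1 / 2).

Lemma bernX_texpX : eqX N (bernX * texpX) 1.
Proof.
move=> m lt_m; rewrite coefM coefC.
have -> : \sum_(j < m.+1) bernX`_j * texpX`_(m - j) =
   \sum_(j < m.+1) bernoulli j / (j`!%:R * (m.+1 - j)`!%:R).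
  apply: eq_bigr => j _; have := ltn_ord j => lt_j.
  rewrite !coef_poly !ifT; [|lia..].
  by rewrite -mulrA invfM -subSn.
case: m lt_m => [|m] lt_m.
  by rewrite big_ord_recr big_ord0 /= subn0 /bernoulli /= fact0 add0r.
rewrite big_ord_recr /= bernoulliS subSnn.
set S := \sum_(j < m.+1) _; rewrite mulr1; field.
by rewrite (factq_neq0 m.+1).
Qed.

Lemma X_texpX : eqX N ('X * texpX) (ex 1 - 1).
Proof.
move=> [|i] lt_i; rewrite coefXM coefB coef_expX // coefC /=.
  by rewrite fact0 invr1 mulr1 subrr.
by rewrite expr1n mulr1 subr0 coef_poly ltnW.
Qed.

Lemma X_sinhcX a : eqX N (a%:P * 'X * sinhcX a) (ex (a / 2) - ex (- (a / 2))).
Proof.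
move=> i lt_i; rewrite -mulrA coefCM coefXM coefB !coef_expX //=.
case: i lt_i => [|i] lt_i /=; first by rewrite mulr0 subrr.
rewrite coef_poly ltnW // exprNn -signr_odd /=.
case: (odd i) => /=; first by rewrite mulr0 expr0 mul1r subrr.
rewrite expr1 mulN1r mulrN opprK -mulr2n exprMn exprVn !exprS.
by field; rewrite expf_neq0 // factq_neq0.
Qed.

(** Multiplying $S(z)$ by $e^{z/2}$ gives $(e^z-1)/z$, the inverse of the Bernoulli series.
    Cancelling a factor $z$ costs one order of truncation, hence [N.-1]. *)
Lemma cscX_sinhcX : eqX N.-1 (cscX * sinhcX 1) 1.
Proof.
have e1 : eqX N.-1 (sinhcX 1 * ex (1 / 2)) texpX.
  apply: eqX_cancelX.
  have e := X_sinhcX 1; rewrite mul1r in e.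
  have e0 := @expX_add _ idfun N (2^-1) (- 2^-1); rewrite subrr /= in e0.
  have e2 := @expX_add _ idfun N (2^-1) (2^-1).
  rewrite (_ : 2^-1 + 2^-1 = 1) in e2; last by field.
  apply: eqX_trans (eqX_sym X_texpX).
  rewrite mul1r.
  have e3 := eqX_trans e0 (@expX_0 _ idfun N).
  apply: (eqX_lin3 e e2 e3 (c1 := ex (2^-1)) (c2 := 1) (c3 := -1)).
  by ring.
rewrite /cscX; apply: (eqX_lin2 e1 (eqX_leq (leq_pred N) bernX_texpX) (c1 := bernX) (c2 := 1)).
by ring.
Qed.

End Series.

Section Series2.

Variable N : nat.

Notation ex := (@expX rat idfun N).

Lemma coef_scaleX (R : comNzRingType) (c : R) (p : {poly R}) i :
  (p \Po (c *: 'X))`_i = c ^+ i * p`_i.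
Proof.
rewrite comp_polyE coef_sum.
under eq_bigr => j _ do rewrite coefZ exprZn coefZ coefXn.
have [lt_i|le_i] := ltnP i (size p).
  rewrite (bigD1 (Ordinal lt_i)) //= eqxx mulr1 big1 ?addr0 => [|j ne]; first exact: mulrC.
  by rewrite (_ : (i == j) = false) ?mulr0 //; apply: contraNF ne => /eqP e; apply/eqP/val_inj.
rewrite big1 => [|j _]; last by rewrite (_ : (i == j) = false) ?mulr0 //; apply/eqP; have := ltn_ord j; lia.
by rewrite nth_default ?mulr0.
Qed.

Lemma eqX_scaleX (R : comNzRingType) (c : R) (p q : {poly R}) :
  eqX N p q -> eqX N (p \Po (c *: 'X)) (q \Po (c *: 'X)).
Proof. by move=> e i lt_i; rewrite !coef_scaleX e. Qed.

Lemma expX_scaleX (c a : rat) : ex a \Po (c *: 'X) = ex (c * a).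
Proof.
apply/polyP => i; rewrite coef_scaleX !coef_poly.
by case: ifP => _; rewrite ?mulr0 // exprMn /=; ring.
Qed.

(* [2 B(z/2) - B(z)] is [z / (2 sinh(z/2))] because
   [1/(e^w - 1) - 1/(e^(2w) - 1) = e^w/(e^(2w) - 1)]. *)
Lemma coef_cscX k : (k < N.-1)%N ->
  (cscX N)`_k = (2 / 2 ^+ k - 1) * (bernoulli k / k`!%:R).
Proof.
move=> lt_k.
set sc := fun p : {poly rat} => p \Po (2^-1 *: 'X).
have sc1 : sc 1 = 1 by rewrite /sc comp_polyC.
have e1 := @bernX_texpX N.
have e2 : eqX N (sc (bernX N) * sc (texpX N)) 1.
  by rewrite -rmorphM -sc1; apply: eqX_scaleX.
(* This is $e^z - 1 = (e^{z/2}-1)(e^{z/2}+1)$ divided by $z/2$. *)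
have e3 : eqX N.-1 (2 * texpX N) (sc (texpX N) * (ex (1 / 2) + 1)).
  apply: eqX_cancelX; rewrite mul1r.
  have eU := @X_texpX N; have eU2 := eqX_scaleX (2^-1) eU.
  rewrite rmorphM rmorphB /= comp_polyX -/(sc 1) sc1 -/(sc _) expX_scaleX mulr1 in eU2.
  have ee := @expX_add _ idfun N (2^-1) (2^-1).
  rewrite (_ : 2^-1 + 2^-1 = 1) in ee; last by field.
  have e2' : 'X = 2 * (2^-1 *: 'X) :> {poly rat}.
    by rewrite -polyC_natr mul_polyC scalerA divff // scale1r.
  apply: (eqX_lin3 eU eU2 ee (c1 := 2) (c2 := - 2 * (ex (2^-1) + 1)) (c3 := -2)).
  by rewrite {2}e2'; ring.
have e4 : eqX N.-1 (cscX N) (2 * sc (bernX N) - bernX N).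
  apply: (eqX_lin3 (eqX_leq (leq_pred N) e1) (eqX_leq (leq_pred N) e2) e3
    (c1 := 2 * sc (bernX N)) (c2 := - bernX N * (ex (1 / 2) + 1))
    (c3 := - sc (bernX N) * bernX N)).
  by rewrite /cscX; ring.
rewrite e4 // coefB -polyC_natr coefCM coef_scaleX coef_poly ifT; last by lia.
by rewrite exprVn; ring.
Qed.

(** The witness [r] is $(z/2)\coth(z/2)$, built as $cV$ with $c = \cosh(z/2)$ and $V = 1/S$. The
    first congruence is the logarithmic derivative of $V$, the second the Riccati equation of
    [r]. *)
Lemma cscX_ode : exists r : {poly rat},
  [/\ r`_0 = (cscX N)`_0,
   eqX N.-1 ('X * (cscX N)^`()) (cscX N - cscX N * r)
   & eqX N.-1 ('X * r^`()) (4^-1%:P * 'X^2 + r - r ^+ 2)].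
Proof.
set V := cscX N; set S := sinhcX N 1.
have h1 : eqX N.-1 (V * S) 1 := @cscX_sinhcX N.
pose c : {poly rat} := 2^-1%:P * (ex (2^-1) + ex (- 2^-1)).
pose e1 := ex (2^-1); pose e2 := ex (- 2^-1).
have leN := leq_pred N.
have hS : eqX N ('X * S) (e1 - e2).
  by have := @X_sinhcX N 1; rewrite !mul1r.
have t1 : eqX N ('X * e1^`()) (2^-1%:P * 'X * e1) := @theta_expX _ idfun N _.
have t2 : eqX N ('X * e2^`()) (- 2^-1%:P * 'X * e2).
  by have := @theta_expX _ idfun N (- 2^-1); rewrite polyCN.
have h2 := eqX_theta h1; rewrite derivC mulr0 derivM in h2.
have hS' := eqX_theta hS; rewrite derivM derivX derivB in hS'.
have h3 : eqX N.-1 ('X * S^`()) (c - S).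
  apply: eqX_cancelX.
  by apply: (eqX_lin3 hS' t1 t2 (c1 := 1) (c2 := 1) (c3 := -1)); rewrite /c -/e1 -/e2; ring.
have h4 : eqX N.-1 ('X * V^`()) (V - V * (c * V)).
  by apply: (eqX_lin3 h1 h2 h3 (c1 := V - 'X * V^`()) (c2 := V) (c3 := - V ^+ 2)); ring.
have h5 : eqX N ('X * c^`()) (4^-1%:P * 'X^2 * S).
  have -> : 4^-1%:P = 2^-1%:P * 2^-1%:P :> {poly rat} by rewrite -polyCM; congr polyC; field.
  apply: (eqX_lin3 hS t1 t2 (c1 := - (2^-1%:P * 2^-1%:P * 'X)) (c2 := 2^-1%:P) (c3 := 2^-1%:P)).
  by rewrite /c -/e1 -/e2 derivM derivC derivD; ring.
exists (c * V); split => //.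
- rewrite coef0M; case: (posnP N) => [N0|N_gt0].
    by rewrite /V /cscX /bernX !coef0M N0 coef_poly mul0r mulr0.
  by rewrite /c coefCM coefD !coef_expX //= !expr0 !mulr1 fact0; field.
apply: (eqX_lin3 (eqX_leq leN h5) h1 h4 (c1 := V) (c2 := 4^-1%:P * 'X^2) (c3 := c)).
by rewrite derivM; ring.
Qed.

End Series2.

(** * Alternating signs from the Riccati equation *)

Lemma sumr_gt0_ord (n : nat) (F : nat -> rat) (j : nat) :
  (j < n)%N -> (forall i, (i < n)%N -> 0 <= F i) -> 0 < F j ->
  0 < \sum_(i < n) F i.
Proof.
move=> lt_j F_ge0 Fj; rewrite (bigD1 (Ordinal lt_j)) //= ltr_pwDl //.
by apply: sumr_ge0 => i _; apply: F_ge0.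
Qed.

Section SignAlternation.

Variables (M : nat) (v r : nat -> rat).
Hypotheses (v0 : v 0%N = 1) (r0 : r 0%N = 1).
Hypothesis vE : forall n, (n < M)%N ->
  n%:R * v n = v n - \sum_(i < n.+1) v i * r (n - i)%N.
Hypothesis rE : forall n, (n < M)%N ->
  n%:R * r n = 4^-1 * (n == 2)%:R + r n - \sum_(i < n.+1) r i * r (n - i)%N.

(** The two extreme terms of the convolution both equal [r n.+2]; moving them to the left produces
    the factor [n.+3]. *)
Lemma riccati_rec n : (n.+2 < M)%N -> (n.+3)%:R * r n.+2 =
  4^-1 * (n == 0)%:R - \sum_(i < n.+1) r i.+1 * r (n.+1 - i)%N.
Proof.
move=> lt_n; have := rE lt_n; rewrite big_ord_recr big_ord_recl /= subn0 subnn r0.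
under eq_bigr => i _ do rewrite /bump /= add1n subSS.
rewrite !eqSS -[n.+3%:R]natr1; set S := \sum_(i < n.+1) _; lra.
Qed.

(** A product of odd total index has an odd-index factor, which vanishes. In even degree the minus
    sign of the recursion gives all products of earlier even coefficients one common sign; the term
    $z^2/4$ starts the pattern. *)
Lemma riccati_sign n : (n < M)%N -> (0 < n)%N ->
  if odd n then r n = 0 else 0 < (-1) ^+ n./2.+1 * r n.
Proof.
have [k] := ubnP n; elim: k n => // k IH [|[|n]] /ltnSE le_n lt_n _ //.
  have := rE lt_n; rewrite 2!big_ord_recr big_ord0 /= r0; lra.
have rec := riccati_rec lt_n.
have nz : n.+3%:R != 0 :> rat by rewrite pnatr_eq0.
rewrite /= negbK; case: ifP => odd_n.
  apply: (mulfI nz); rewrite rec mulr0.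
  rewrite (_ : (n == 0) = false) ?mulr0 ?sub0r; last by case: n odd_n {le_n lt_n rec nz}.
  rewrite big1 ?oppr0 // => i _; have lt_i := ltn_ord i.
  case odd_i : (odd i); last first.
    by have := IH i.+1; rewrite /= odd_i /= => -> //; rewrite ?mul0r //; lia.
  have := IH (n.+1 - i)%N; rewrite oddB /= ?odd_n ?odd_i //=; last lia.
  by move=> -> //; rewrite ?mulr0 //; lia.
have n3 : 0 < n.+3%:R :> rat by rewrite ltr0n.
rewrite -(pmulr_rgt0 _ n3) mulrCA rec.
(* As [n] is even, the indices [i.+1] and [n.+1 - i] have the same parity: [F i] is positive for odd
   [i] and zero for even [i]. *)
pose F i := (-1) ^+ n./2.+1 * (r i.+1 * r (n.+1 - i)%N).
have F_odd i : (i < n.+1)%N -> odd i -> 0 < F i.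
  move=> lt_i odd_i.
  have := IH i.+1; rewrite /= odd_i /= => /(_ _ _ isT) p1.
  have := IH (n.+1 - i)%N; rewrite oddB /= ?odd_n ?odd_i //=; last lia.
  move=> p2; rewrite /F.
  have -> : n./2.+1 = (i.+1./2 + (n.+1 - i)./2)%N.
    have e : n.+2 = (i.+1 + (n.+1 - i))%N by rewrite addSn subnKC ?(ltnW lt_i).
    by rewrite -[n./2.+1]/(n.+2./2) e halfD /= odd_i.
  have -> : (-1) ^+ (i.+1./2 + (n.+1 - i)./2) * (r i.+1 * r (n.+1 - i)%N) =
     ((-1) ^+ i.+1./2.+1 * r i.+1) * ((-1) ^+ (n.+1 - i)./2.+1 * r (n.+1 - i)%N).
    by rewrite !exprS exprD; ring.
  by rewrite mulr_gt0 //; [apply: p1 | apply: p2]; lia.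
have F_ge0 i : (i < n.+1)%N -> 0 <= F i.
  move=> lt_i; case odd_i : (odd i); first by rewrite ltW ?F_odd.
  by have := IH i.+1; rewrite /F /= odd_i /= => ->; rewrite ?mul0r ?mulr0 //; lia.
have -> : (-1) ^+ n./2.+2 * (4^-1 * (n == 0)%:R - \sum_(i < n.+1) r i.+1 * r (n.+1 - i)%N)
  = 4^-1 * (-1) ^+ n./2 * (n == 0)%:R + \sum_(i < n.+1) F i.
  by rewrite /F -mulr_sumr !exprS; ring.
have [n0|n_neq0] := eqVneq n 0%N.
  rewrite {1}n0 expr0 !mulr1 ltr_wpDr // ?invr_gt0 //.
  by apply: sumr_ge0 => i _; apply: F_ge0.
rewrite mulr0 add0r (@sumr_gt0_ord _ _ 1) //; first by lia.
by apply: F_odd => //; lia.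
Qed.

(** After [v n] cancels, $n v_n = -\sum_{i<n} v_i r_{n-i}$. Terms with odd $i$ vanish, those with
    even $i$ share one sign, and $i = 0$ is a nonzero term. *)
Lemma riccati_v_neq0 n : (n < M)%N -> ~~ odd n -> v n != 0.
Proof.
suff pos : forall n, (n < M)%N -> ~~ odd n -> 0 < (-1) ^+ n./2 * v n.
  by move=> lt_n ev; have := pos n lt_n ev; apply: contraTneq => ->; rewrite mulr0 ltxx.
move=> {}n; have [k] := ubnP n; elim: k n => // k IH [|n] /ltnSE le_n lt_n ev.
  by rewrite expr0 v0 mul1r.
have n1 : 0 < n.+1%:R :> rat by rewrite ltr0n.
rewrite -(pmulr_rgt0 _ n1) mulrCA vE // big_ord_recr /= subnn r0 mulr1.
have -> : v n.+1 - (\sum_(i < n.+1) v i * r (n.+1 - i)%N + v n.+1) =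
   - \sum_(i < n.+1) v i * r (n.+1 - i)%N by ring.
pose F i := (-1) ^+ (uphalf n).+1 * (v i * r (n.+1 - i)%N).
have F_ev i : (i < n.+1)%N -> ~~ odd i -> 0 < F i.
  move=> lt_i ev_i; have p1 := IH i _ _ ev_i.
  have := @riccati_sign (n.+1 - i)%N; rewrite oddB; last lia.
  rewrite (negPf ev) (negPf ev_i) /= => p2; rewrite /F.
  have -> : (uphalf n).+1 = (i./2 + (n.+1 - i)./2.+1)%N.
    have e : n.+1 = (i + (n.+1 - i))%N by rewrite subnKC ?(ltnW lt_i).
    by rewrite addnS -[uphalf n]/(n.+1./2) {1}e halfD (negPf ev_i).
  by rewrite exprD mulrACA mulr_gt0 //; [apply: p1 | apply: p2]; lia.
have -> : (-1) ^+ uphalf n * (- \sum_(i < n.+1) v i * r (n.+1 - i)%N) = \sum_(i < n.+1) F i.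
  by rewrite /F -mulr_sumr !exprS; ring.
apply: (@sumr_gt0_ord _ _ 0) => // [i lt_i|]; last exact: F_ev.
case odd_i : (odd i); last by rewrite ltW ?F_ev ?odd_i.
have := @riccati_sign (n.+1 - i)%N; rewrite oddB; last lia.
by rewrite /F (negPf ev) odd_i /= => ->; rewrite ?mulr0 //; lia.
Qed.

End SignAlternation.

Lemma cscX_coef0 N : (1 < N)%N -> (cscX N)`_0 = 1.
Proof. by move=> lt_N; rewrite coef_cscX; [rewrite expr0 fact0 /bernoulli /=; field | lia]. Qed.

Lemma cscX_neq0 N n : (n < N.-1)%N -> ~~ odd n -> (cscX N)`_n != 0.
Proof.
move=> lt_n ev; have [r [r0 hv hr]] := cscX_ode N.
have c0 : (cscX N)`_0 = 1 by apply: cscX_coef0; lia.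
apply: (@riccati_v_neq0 N.-1 (fun i => (cscX N)`_i) (fun i => r`_i)) => //.
- by rewrite r0.
- move=> m lt_m; have := hv m lt_m; rewrite coefB [(cscX N * r)`_m]coefM => <-.
  by case: (m) => [|m']; rewrite coefXM /= ?mul0r // coef_deriv mulr_natl.
move=> m lt_m; have := hr m lt_m; rewrite coefB coefD coefCM coefXn expr2 [(r * r)`_m]coefM => <-.
by case: (m) => [|m']; rewrite coefXM /= ?mul0r // coef_deriv mulr_natl.
Qed.

(** * One-part double Hurwitz numbers *)

Section OrbitSeries.

Variables (N : nat) (c : seq nat) (Q : {poly rat}).
Hypothesis QE : ('X - 1) * Q = \prod_(k <- c) qnum k.

Notation ex := (@expX rat idfun N).
Let d : rat := (sumn c)%:R.
Let W := ex (- ((d - 1) / 2)) * (Q \Po ex 1).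

(** [W] is $q^{-(d-1)/2}Q$ at $q = e^z$, so the sums of [nfactor_coef] reappear here. *)
Lemma coef_orbit_series t : (t < N)%N ->
  W`_t = (\sum_(j < size Q) Q`_j * (j%:R - (d - 1) / 2) ^+ t) / t`!%:R.
Proof.
move=> lt_t; rewrite /W comp_polyE mulr_sumr coef_sum mulr_suml.
apply: eq_bigr => j _; rewrite -scalerAr coefZ -mulrA; congr (_ * _).
have e : eqX N (ex (- ((d - 1) / 2)) * ex 1 ^+ j) (ex (j%:R - (d - 1) / 2)).
  rewrite [j%:R - _]addrC; apply: eqX_trans (@expX_add _ idfun N _ _).
  by apply: eqX_mul => //; have := @expX_natM _ idfun N 1 j; rewrite mulr1.
by rewrite e // coef_expX //= mulrC.
Qed.

(** Distributing $e^{-dz/2}$ over the parts turns each $e^{kz}-1$ into $2\sinh(kz/2) = kz\,S(kz)$.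
    The remaining factor $(e^z-1)e^{-z/2} = zS(z)$ of [W] is removed by cancelling $z$ and
    multiplying by [cscX]. *)
Lemma orbit_seriesE : (0 < size c)%N ->
  eqX N.-1 W (cscX N * ('X^((size c).-1) *
    ((\prod_(k <- c) k%:R)%:P * \prod_(k <- c) sinhcX N k%:R))).
Proof.
move=> sz.
have hB : (ex 1 - 1) * (Q \Po ex 1) = \prod_(k <- c) (ex 1 ^+ k - 1).
  have /(congr1 (fun p => p \Po ex 1)) := QE.
  rewrite rmorphM rmorphB /= comp_polyX comp_polyC => ->.
  rewrite rmorph_prod; apply: eq_bigr => k _.
  by rewrite /qnum rmorphB /= comp_polyC rmorphXn /= comp_polyX.
have hd : eqX N (ex (- (d / 2))) (\prod_(k <- c) ex (- (k%:R / 2))).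
  apply: eqX_trans (eqX_sym (@expX_sum _ idfun N _ c (fun k => - (k%:R / 2)))).
  by rewrite sumrN -mulr_suml -natr_sum -sumnE.
have h1 : eqX N (ex (- 2^-1) * W) (ex (- (d / 2)) * (Q \Po ex 1)).
  rewrite /W mulrA; apply: eqX_mul => //.
  rewrite (_ : - (d / 2) = - 2^-1 - (d - 1) / 2); first exact: expX_add.
  by field.
have h2 : eqX N ((ex 1 - 1) * (ex (- 2^-1) * W))
    (\prod_(k <- c) (k%:R%:P * 'X * sinhcX N k%:R)).
  apply: (@eqX_trans _ _ ((ex 1 - 1) * (ex (- (d / 2)) * (Q \Po ex 1)))).
    exact: eqX_mul.
  rewrite mulrCA hB.
  apply: eqX_trans (_ : eqX N _ (\prod_(k <- c) ex (- (k%:R / 2)) * \prod_(k <- c) (ex 1 ^+ k - 1))) _.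
    exact: eqX_mul.
  rewrite -big_split /=; apply: eqX_prod => k.
  apply: eqX_trans (eqX_sym (@X_sinhcX N k%:R)).
  have e1 := @expX_natM _ idfun N 1 k; rewrite mulr1 in e1.
  have e2 := @expX_add _ idfun N (- (k%:R / 2)) k%:R.
  rewrite (_ : - (k%:R / 2) + k%:R = k%:R / 2) in e2; last by field.
  by apply: (eqX_lin2 e1 e2 (c1 := ex (- (k%:R / 2))) (c2 := 1)); ring.
have h3 : eqX N ('X * sinhcX N 1) ((ex 1 - 1) * ex (- 2^-1)).
  have e1 := @X_sinhcX N 1; rewrite !mul1r in e1.
  have e2 := @expX_add _ idfun N 1 (- 2^-1).
  rewrite (_ : 1 - 2^-1 = 2^-1) in e2; last by field.
  by apply: (eqX_lin2 e1 e2 (c1 := 1) (c2 := -1)); ring.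
set Y := _%:P * \prod_(k <- c) sinhcX N k%:R.
have h4 : eqX N.-1 (sinhcX N 1 * W) ('X^((size c).-1) * Y).
  apply: eqX_cancelX; rewrite mulrA; apply: eqX_trans (_ : eqX N _ ((ex 1 - 1) * ex (- 2^-1) * W)) _.
    exact: eqX_mul.
  rewrite -mulrA; apply: eqX_trans h2 _.
  rewrite !big_split /= [X in _ * X * _]big_const_seq count_predT iter_mulr_1.
  rewrite mulrA -exprS prednK // -(rmorph_prod (@polyC rat)) /= -mulrA mulrCA.
  exact: eqX_refl.
apply: (eqX_lin2 (@cscX_sinhcX N) h4 (c1 := - W) (c2 := cscX N)); ring.
Qed.

End OrbitSeries.

Lemma cycle_type_prod (R : comNzRingType) d (s : {perm 'I_d}) (F : nat -> R) :
  \prod_(X in porbits s) F #|X| = \prod_(k <- cycle_type_seq s) F k.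
Proof. by rewrite /cycle_type_seq /image_mem big_map big_enum. Qed.

(* The formula of Goulden, Jackson and Vakil. *)
Lemma hurwitzHE g b N : (0 < g)%N -> (0 < size b)%N -> all (ltn 0) b ->
  (2 * g + size b < N)%N ->
  hurwitzH g b / ((2 * g + size b - 1)`!%:R * (sumn b)%:R) =
  (sumn b)%:R ^+ (2 * g + size b - 3) *
  (cscX N * \prod_(k <- b) sinhcX N k%:R)`_(2 * g).
Proof.
move=> g_gt0 sz b_gt0 lt_N; set d := sumn b; set t := (2 * g + size b - 1)%N.
have d_gt0 : (0 < d)%N by rewrite /d; case: (b) sz b_gt0 => //= a b' _ /andP[]; lia.
pose x0 : 'I_d := Ordinal d_gt0.
set Y := (_)`_(2 * g).
have K := card_cycle_type sz b_gt0 (erefl d).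
have tf (s : {perm 'I_d}) : has_cycle_type s b ->
    d%:R * (nfactor t s^-1)%:R = d%:R ^+ t * (t`!%:R * ((\prod_(k <- b) k%:R) * Y)) :> rat.
  move=> sb; set u := (s^-1)%g.
  have ub : perm_eq (cycle_type_seq u) b.
    by rewrite /cycle_type_seq /u porbitsV.
  have QE : ('X - 1) * orbitQ x0 u = \prod_(k <- b) qnum k.
    by rewrite orbitQE /orbitB cycle_type_prod; apply: perm_big.
  rewrite (@nfactor_coef _ x0 t u _ (leqnn _)); congr (_ * _).
  have lt_t : (t < N)%N by lia.
  have := @coef_orbit_series N b (orbitQ x0 u) t lt_t; rewrite -/d.
  set S := \sum_(j < _) _ => /esym/(canRL (divfK (factq_neq0 t))) ->.
  rewrite mulrC; congr (_ * _).
  rewrite (@orbit_seriesE N b _ QE sz); last by lia.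
  (* The power $z^{n-1}$ shifts the index $t = 2g+n-1$ down to $2g$. *)
  rewrite mulrCA coefXnM ifF; last by lia.
  rewrite (_ : t - (size b).-1 = 2 * g)%N; last by lia.
  by rewrite mulrCA coefCM.
have tE : (2 * g - 1 + size b = t)%N by lia.
rewrite /hurwitzH tE -/d; set cnt := hurwitz_count d t b.
set card := #|_| in K; set au := aut_part d b in K *.
have hc : d%:R * cnt%:R =
    card%:R * (d%:R ^+ t * (t`!%:R * ((\prod_(k <- b) k%:R) * Y))) :> rat.
  rewrite /cnt hurwitz_countE natr_sum mulr_sumr (eq_bigr _ tf) sumr_const.
  rewrite [RHS]mulr_natl; congr (_ *+ _); apply: eq_card => s.
  by rewrite inE.
have hK : card%:R * ((\prod_(k <- b) k%:R) * au%:R) = d`!%:R :> rat.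
  by rewrite -K !natrM natr_prod.
have d_neq0 : d%:R != 0 :> rat by rewrite pnatr_eq0 -lt0n.
have := factq_neq0 d; rewrite -hK !mulf_eq0 !negb_or => /and3P[nc np na].
have -> : cnt%:R = card%:R * (d%:R ^+ t * (t`!%:R * ((\prod_(k <- b) k%:R) * Y))) / d%:R :> rat.
  by rewrite -hc mulrAC divff // mul1r.
(* Two powers of $d$ are divided out, one for [hc] and one for the normalization; by [hK] the class
   size cancels against [aut_part], $d!$ and the product of the parts. *)
rewrite (_ : t = (2 * g + size b - 3).+2) ?(exprS _ _.+1) ?(exprS _ (_ - _)); last by lia.
by field; rewrite nc np na d_neq0 factq_neq0.
Qed.

(** * The Hurwitz polynomial *)

Definition sinhc_coef (j : nat) : rat :=
  if odd j then 0 else (2 ^+ j * (j.+1)`!%:R)^-1.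

(* The coefficient of [u^b] in [e^(u w) * sinh(u/2)/(u/2)]. *)
Definition expsinhc (b : nat) : {poly rat} :=
  \poly_(i < b.+1) (i`!%:R^-1 * sinhc_coef (b - i)).

Lemma coef_XaddC_exp (R : comNzRingType) (c : R) m i :
  (('X + c%:P) ^+ m)`_i = c ^+ (m - i) * 'C(m, i)%:R.
Proof.
rewrite addrC exprDn coef_sum.
under eq_bigr => j _ do rewrite -rmorphXn -mulrnAl -polyCMn coefCM coefXn.
have [le_i|lt_i] := leqP i m.
  rewrite (bigD1 (Ordinal (le_i : (i < m.+1)%N))) //= eqxx mulr1 big1 ?addr0.
    by rewrite mulr_natr.
  move=> j ne; rewrite (_ : (i == j) = false) ?mulr0 //.
  by apply: contraNF ne => /eqP e; apply/eqP/val_inj.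
rewrite bin_small // mulr0 big1 // => j _.
by rewrite (_ : (i == j) = false) ?mulr0 //; apply/eqP; have := ltn_ord j; lia.
Qed.

(** Both sides are the coefficient of $u^b$ in $2e^{ux}\sinh(u)/u$; on the right $u$ and $x$ are
    rescaled by 2 and $1/2$. *)
Lemma expsinhc_ChatE b :
  (('X + 1) ^+ b.+1 - ('X - 1) ^+ b.+1) * ((b.+1)`!%:R^-1)%:P =
  2 ^+ b.+1 *: (expsinhc b \Po (2^-1 *: 'X)).
Proof.
apply/polyP => i; rewrite coefMC coefB -polyCN !coef_XaddC_exp.
rewrite coefZ coef_scaleX coef_poly expr1n.
have [le_i|lt_i] := ltnP i b.+1; last first.
  rewrite !mulr0 -mulrBl; have [lt|le] := ltnP b.+1 i; first by rewrite bin_small // mulr0 mul0r.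
  have -> : i = b.+1 by lia.
  by rewrite subnn subrr !mul0r.
rewrite subSn // exprS -signr_odd /sinhc_coef; case: (odd (b - i)).
  by rewrite expr1 mulrNN mulr1 subrr mul0r !mulr0.
have -> : (b.+1)`!%:R = 'C(b.+1, i)%:R * (i`!%:R * ((b - i).+1)`!%:R) :> rat.
  by rewrite -(bin_fact (leqW le_i : (i <= b.+1)%N)) natrM natrM subSn.
have -> : 2 ^+ b.+1 = 2 * (2 ^+ i * 2 ^+ (b - i)) :> rat.
  by rewrite -exprD subnKC // exprS.
rewrite exprVn expr0 mulr1; field.
have -> : 'C(b.+1, i)%:R != 0 :> rat by rewrite pnatr_eq0 -lt0n bin_gt0 leqW.
by rewrite !factq_neq0 !expf_neq0.
Qed.

(** The size bound will give vanishing below degree $D = 2g+n-3$, the top coefficient the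
    multinomial at $b = D$. *)
Lemma prod_top_coef (R : comNzRingType) (I : Type) (r : seq I)
    (F : I -> {poly R}) (b : I -> nat) :
  (forall i, size (F i) <= (b i).+1)%N ->
  (size (\prod_(i <- r) F i)%R <= (\sum_(i <- r) b i).+1)%N /\
  (\prod_(i <- r) F i)`_(\sum_(i <- r) b i) = \prod_(i <- r) (F i)`_(b i).
Proof.
move=> sF; elim: r => [|i r [szr cr]].
  by rewrite !big_nil size_poly1 coefC.
rewrite !big_cons; split.
  by apply: leq_trans (size_polyMleq _ _) _; have := sF i; lia.
rewrite coefM (bigD1 (Ordinal (leq_addr _ _ : (b i < (b i + _).+1)%N))) //= addKn cr.
rewrite [X in _ + X]big1 ?addr0 // => j ne.
have [lt_j|le_j] := ltnP (b i) j.
  by rewrite nth_default ?mul0r // (leq_trans (sF i)).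
have lt_j : (j < b i)%N.
  rewrite ltn_neqAle le_j andbT; apply: contraNneq ne => e.
  by apply/eqP/val_inj.
by rewrite [X in _ * X]nth_default ?mulr0 // (leq_trans szr) //; lia.
Qed.

Lemma size_expsinhc b : (size (expsinhc b) <= b.+1)%N.
Proof. exact: size_poly. Qed.

Lemma mdeg_mono_of n (bs : n.-tuple nat) : mdeg (mono_of bs) = sumn bs.
Proof.
rewrite mdegE sumnE big_tuple; apply: eq_bigr => i _.
by rewrite mnmE.
Qed.

(** The coefficient of $w^D$ uses $D$ of the degree of [m]; the other [mdeg m - D] count powers of
    $z$ from the factors $S(\beta_i z)$, which leaves [D + 2 * g - mdeg m] for $1/S(z)$. Above the
    upper bound this subtraction would be truncated to 0, hence the guard. *)
Definition hurwitzP_coef (g n N : nat) (m : 'X_{1..n}) : rat :=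
  let D := (2 * g + n - 3)%N in
  if (D <= mdeg m <= D + 2 * g)%N then
    D`!%:R * (cscX N)`_(D + 2 * g - mdeg m) * (\prod_(i < n) expsinhc (m i))`_D
  else 0.

Lemma Chat_expsinhc g n (bs : n.-tuple nat) :
  Chat g bs = (2 * g + n - 3)`!%:R * (sumn bs + 3 - 2 * g)`!%:R *
    (2 ^+ (sumn bs + n) * 2 ^- (2 * g + n - 3)
       * (\prod_(i < n) expsinhc (mono_of bs i))`_(2 * g + n - 3)).
Proof.
rewrite /Chat; congr (_ * _).
under eq_bigr => i _ do rewrite expsinhc_ChatE -mul_polyC.
rewrite big_split /= -rmorph_prod -rmorph_prod coefCM coef_scaleX exprVn mulrA.
have -> : \prod_(i < n) expsinhc (mono_of bs i) = \prod_(i < n) expsinhc (tnth bs i).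
  by apply: eq_bigr => i _; rewrite mnmE.
congr (_ * _ * _).
have -> : 2 ^+ (sumn bs + n) = 2 ^+ (\sum_(i < n) (tnth bs i).+1)%N :> rat.
  congr (_ ^+ _); rewrite sumnE big_tuple.
  under [in RHS]eq_bigr => i _ do rewrite -addn1.
  by rewrite big_split /= sum1_card card_ord.
by rewrite expr_sum.
Qed.

(** The terms with $k < K = b+3-2g$ vanish through [invfact]. After the shift $k = K + l$ the sum is
    the Cauchy product for $e^{z/2}\cdot z/(e^z-1)$, times $2^{-K}$. *)
Lemma Cbgn_cscX g n b N : (2 * g + n - 3 <= b <= 2 * g + n - 3 + 2 * g)%N ->
  (0 < g)%N -> (0 < n)%N -> (2 * g + n < N)%N ->
  Cbgn b g n = (b + 3 - 2 * g)`!%:R^-1 * 2 ^- (b + 3 - 2 * g) *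
    (cscX N)`_(2 * g + n - 3 + 2 * g - b).
Proof.
move=> /andP[le_b ge_b] g_gt0 n_gt0 lt_N; rewrite /Cbgn.
set K := (b + 3 - 2 * g)%N; set q := (2 * g + n - 3 + 2 * g - b)%N.
have -> : invfact (b%:Z + 3 - 2 * g%:Z) = K`!%:R^-1.
  by rewrite (_ : b%:Z + 3 - 2 * g%:Z = K%:Z) //; rewrite /K; lia.
rewrite -mulrA; congr (_ * _).
have e : (2 * g + n).+1 = (K + q.+1)%N by rewrite /K /q; lia.
rewrite e big_split_ord /= big1 ?add0r => [|i _]; last first.
  rewrite (_ : (_ + _ - _ - _ : int) = Negz (K - i.+1)%N) ?mul0r //.
  by have := ltn_ord i; rewrite /K NegzE; lia.
rewrite /cscX coefMr mulr_sumr; apply: eq_bigr => l _; have lt_l := ltn_ord l.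
rewrite (_ : ((K + l)%N%:Z + 2 * g%:Z - b%:Z - 3 : int) = l%:Z); last by rewrite /K; lia.
rewrite coef_poly ifT; last by rewrite /q in lt_l *; lia.
rewrite coef_expX; last by rewrite /q in lt_l *; lia.
have -> : (2 * g + n - (K + l) = q - l)%N by rewrite /K /q; lia.
rewrite /= natrX exprD div1r exprVn; field.
by rewrite !factq_neq0 !expf_neq0.
Qed.

(** The outer variable is $u$ and the coefficients are polynomials in $w$: this is the series
    $e^{uw}S(u)$ behind [expsinhc], with $u$ replaced by $au$ in $S$ and in the exponential. *)
Lemma expsinhc_factor N (a : rat) :
  eqX N (\poly_(k < N) (a ^+ k *: expsinhc k))
        (expX (@polyC rat) N (a *: 'X) * map_poly (@polyC rat) (sinhcX N a)).
Proof.
move=> k lt_k; rewrite coef_poly lt_k coefM /expsinhc poly_def scaler_sumr.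
apply: eq_bigr => i _; have lt_i := ltn_ord i.
rewrite coef_expX; last lia.
rewrite coef_map coef_poly ifT; last lia.
have -> : a ^+ k = a ^+ i * a ^+ (k - i) by rewrite -exprD subnKC.
rewrite /sinhc_coef /= exprZn -!mul_polyC; case: (odd _).
  by rewrite mulr0 polyC0 mul0r !mulr0.
by rewrite !polyCM; ring.
Qed.

Section HurwitzPolynomial.

Variables (g n : nat).
Let D := (2 * g + n - 3)%N.
Let N := (4 * g + n).+1.

Definition mnm_of_ffun (f : {ffun 'I_n -> 'I_N}) : 'X_{1..n} :=
  [multinom (f i : nat) | i < n].

(** Exponents below [N] suffice, as [hurwitzP_coef] vanishes above degree $D + 2g < N$. *)
Definition hurwitzP : {mpoly rat[n]} :=
  \sum_f hurwitzP_coef g N (mnm_of_ffun f) *: 'X_[mnm_of_ffun f].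

Lemma mcoeff_hurwitzP m : hurwitzP@_m = hurwitzP_coef g N m.
Proof.
rewrite /hurwitzP raddf_sum /=.
under eq_bigr => f _ do rewrite mcoeffZ mcoeffX.
have [lt_m|] := boolP [forall i, (m i < N)%N].
  pose f0 : {ffun 'I_n -> 'I_N} := [ffun i => inord (m i)].
  have f0E : mnm_of_ffun f0 = m.
    by apply/mnmP => i; rewrite mnmE ffunE inordK //; apply: (forallP lt_m).
  rewrite (bigD1 f0) //= f0E eqxx mulr1 big1 ?addr0 // => f ne.
  rewrite (_ : (mnm_of_ffun f == m) = false) ?mulr0 //.
  apply: contraNF ne => /eqP e; apply/eqP/ffunP => i; apply/val_inj.
  by rewrite ffunE /= inordK -?e mnmE.
rewrite negb_forall => /existsP[i]; rewrite -leqNgt => le_i.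
have le_d : (N <= mdeg m)%N by rewrite mdegE (bigD1 i) //=; apply: leq_trans le_i (leq_addr _ _).
rewrite big1 => [|f _]; last first.
  rewrite (_ : (mnm_of_ffun f == m) = false) ?mulr0 //.
  apply/eqP => e; have := ltn_ord (f i); move: le_i; rewrite -e mnmE; lia.
by rewrite /hurwitzP_coef ifF //; apply/negP => /andP[_]; rewrite /N in le_d; lia.
Qed.

(** [Pi] is $\prod_i e^{v_i u w}S(v_i u)$, with monomials graded by the power of $u$. In $e^{uw\sum
    v_i}$ the powers of $u$ and $w$ agree, so the coefficient of $u^{D+j}w^D$ is $(\sum v_i)^D/D!$
    times that of $u^j$ in $\prod_i S(v_i u)$. *)
Lemma meval_hurwitzP (v : 'I_n -> rat) : (0 < g)%N -> (0 < n)%N ->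
  hurwitzP.@[v] = (\sum_i v i) ^+ D *
    (cscX N * \prod_(i < n) sinhcX N (v i))`_(2 * g).
Proof.
move=> g_gt0 n_gt0.
pose Pi := \prod_(i < n) (\poly_(k < N) (v i ^+ k *: expsinhc k)) : {poly {poly rat}}.
have PiE M : (Pi`_M)`_D = \sum_(f : {ffun 'I_n -> 'I_N} | mdeg (mnm_of_ffun f) == M)
    (\prod_i v i ^+ (f i)) * (\prod_i expsinhc (f i))`_D.
  rewrite /Pi; under eq_bigr => i _ do rewrite poly_def.
  rewrite bigA_distr_bigA /= coef_sum coef_sum [RHS]big_mkcond /=.
  apply: eq_bigr => f _.
  have -> : \prod_(i < n) ((v i ^+ f i *: expsinhc (f i)) *: 'X^(f i) : {poly {poly rat}}) =
     ((\prod_i v i ^+ (f i)) *: (\prod_i expsinhc (f i))) *: 'X^(mdeg (mnm_of_ffun f)).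
    rewrite scaler_prod; congr (_ *: _); first by rewrite scaler_prod.
    by rewrite mdegE expr_sum; apply: eq_bigr => i _; rewrite mnmE.
  rewrite coefZ coefXn eq_sym; case: eqP => _; last by rewrite mulr0 coef0.
  by rewrite mulr1 coefZ.
have Pi_eq : eqX N Pi (expX (@polyC rat) N ((\sum_i v i) *: 'X) *
    map_poly (@polyC rat) (\prod_(i < n) sinhcX N (v i))).
  apply: eqX_trans (_ : eqX N _ (\prod_(i < n) (expX (@polyC rat) N (v i *: 'X)
      * map_poly (@polyC rat) (sinhcX N (v i))))) _.
    by apply: eqX_prod => i; apply: expsinhc_factor.
  rewrite big_split /= rmorph_prod; apply: eqX_mul => //.
  by rewrite scaler_suml; apply: expX_sum.
have Pi_coef j : (D + j < N)%N -> (Pi`_(D + j))`_D =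
    D`!%:R^-1 * (\sum_i v i) ^+ D * (\prod_(i < n) sinhcX N (v i))`_j.
  move=> lt_j; rewrite Pi_eq // coefM coef_sum.
  have lt_D : (D < (D + j).+1)%N by rewrite ltnS leq_addr.
  have E (i : 'I_(D + j).+1) : ((expX (@polyC rat) N ((\sum_i v i) *: 'X))`_i *
     (map_poly (@polyC rat) (\prod_(i < n) sinhcX N (v i)))`_(D + j - i))`_D =
     i`!%:R^-1 * (\sum_i v i) ^+ i * (\prod_(i < n) sinhcX N (v i))`_(D + j - i)
       * (D == i)%:R.
    rewrite coef_expX; last by have := ltn_ord i; lia.
    rewrite coef_map coefMC coefCM exprZn coefZ coefXn /=; ring.
  rewrite (eq_bigr _ (fun i _ => E i)) (bigD1 (Ordinal lt_D)) //= eqxx mulr1 addKn.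
  rewrite [X in _ + X]big1 ?addr0 // => i ne; rewrite (_ : (D == i) = false) ?mulr0 //.
  by apply: contraNF ne => /eqP e; apply/eqP/val_inj.
rewrite /hurwitzP raddf_sum /=.
have T f : (hurwitzP_coef g N (mnm_of_ffun f) *: 'X_[mnm_of_ffun f]).@[v] =
   hurwitzP_coef g N (mnm_of_ffun f) * \prod_i v i ^+ (f i).
  by rewrite mevalZ mevalX; congr (_ * _); apply: eq_bigr => i _; rewrite mnmE.
rewrite (eq_bigr _ (fun f _ => T f)) {T}.
transitivity (\sum_(j < (2 * g).+1) D`!%:R * (cscX N)`_(2 * g - j) * (Pi`_(D + j))`_D).
  under [RHS]eq_bigr => j _ do rewrite PiE mulr_sumr.
  rewrite (exchange_big_dep xpredT) //=; apply: eq_bigr => f _.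
  rewrite /hurwitzP_coef -/D; case: ifP => [/andP[leD geD]|out]; last first.
    rewrite mul0r big1 // => j /eqP e; move: out; rewrite e.
    by have := ltn_ord j; lia.
  have lt_j : (mdeg (mnm_of_ffun f) - D < (2 * g).+1)%N by lia.
  rewrite (big_pred1 (Ordinal lt_j)) /=.
    have -> : (2 * g - (mdeg (mnm_of_ffun f) - D) = D + 2 * g - mdeg (mnm_of_ffun f))%N by lia.
    have -> : \prod_(i < n) expsinhc (mnm_of_ffun f i) = \prod_(i < n) expsinhc (f i).
      by apply: eq_bigr => i _; rewrite mnmE.
    by ring.
  move=> j /=; apply/eqP/eqP => [e|->]; last by rewrite /=; lia.
  by apply/val_inj; rewrite /= e; lia.
rewrite coefMr mulr_sumr; apply: eq_bigr => j _.
rewrite Pi_coef; last by have := ltn_ord j; rewrite /D /N; lia.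
have nz := factq_neq0 D; by field.
Qed.

Lemma hurwitzP_sym : hurwitzP \is symmetric.
Proof.
apply/issymP => s; apply/mpolyP => m; rewrite mcoeff_sym !mcoeff_hurwitzP.
rewrite /hurwitzP_coef mdeg_mperm.
suff -> : \prod_(i < n) expsinhc ([multinom m (s i) | i < n] i) = \prod_(i < n) expsinhc (m i) by [].
rewrite [RHS](reindex_inj (@perm_inj _ s)) /=; apply: eq_bigr => i _.
by rewrite mnmE.
Qed.

End HurwitzPolynomial.

(** * Degrees and coefficients of the Hurwitz polynomial *)

Theorem theorem3p8 (g n : nat) (hg : (1 <= g)%N) (hn : (1 <= n)%N) :
  let t := (2 * g + n - 1)%N in
  exists P : {mpoly rat[n]},
  [/\
   (* H^g_{d,d}(beta)/(t! d) is given by P, for every tuple of positive integers *)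
   (forall beta : n.-tuple nat, all (fun x => 0 < x)%N beta ->
      P.@[fun i => (tnth beta i)%:R] =
      hurwitzH g beta / ((t`!)%:R * (sumn beta)%:R)),
   (* P is symmetric *)
   P \is symmetric,
   (* highest degree 4g+n-3, lowest degree 2g+n-3 *)
   [/\ forall m : 'X_{1..n}, m \in msupp P ->
         (2 * g + n - 3 <= mdeg m <= 4 * g + n - 3)%N,
       (exists2 m : 'X_{1..n}, m \in msupp P & mdeg m = (4 * g + n - 3)%N) &
       (exists2 m : 'X_{1..n}, m \in msupp P & mdeg m = (2 * g + n - 3)%N)] &
   (* coefficient formula *)
   [/\ (forall (bs : n.-tuple nat) (k : nat),
      (2 * g <= sumn bs + 3)%N ->
      (sumn bs + 2 * k = 4 * g + n - 3)%N ->
      (-1) ^+ ((4 * g - 3 + n - sumn bs) %/ 2) * bracket g P bs k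
        = Cbgn (sumn bs) g n * Chat g bs),
   (* in particular, b + n even gives 0 *)
   (forall (bs : n.-tuple nat) (k : nat),
      (2 * g <= sumn bs + 3)%N -> ~~ odd (sumn bs + n) ->
      bracket g P bs k = 0) &
   (* the case b = 2g+n-3 *)
   (forall bs : n.-tuple nat,
      sumn bs = (2 * g + n - 3)%N ->
      bracket g P bs g =
        (-1) ^+ g * multinomial bs *
        ((1 - (2 ^ (2 * g - 1))%:R) / ((2 ^ (2 * g - 1))%:R * ((2 * g)`!)%:R))
        * bernoulli (2 * g))]].
Proof.
move=> t; exists (hurwitzP g n).
set D := (2 * g + n - 3)%N; set N := (4 * g + n).+1.
have i0 : 'I_n := Ordinal hn.
(* Powers of a single variable witness both extreme degrees: the other variables contribute
   [expsinhc 0 = 1], and for even [k - D] the coefficients of $S$ and of $1/S$ involved have even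
   index and are nonzero. *)
pose mtop k : 'X_{1..n} := (U_(i0) *+ k)%MM.
have mtopE k i : mtop k i = (k * (i0 == i))%N by rewrite mulmnE mnm1E mulnC.
have mtop_deg k : mdeg (mtop k) = k by rewrite mdegMn mdeg1 mul1n.
have expsinhc0 : expsinhc 0 = 1.
  by apply/polyP => -[|i]; rewrite coef_poly coefC //= /sinhc_coef /= expr0 !mul1r ?invr1.
have mtop_coef k : (\prod_(i < n) expsinhc (mtop k i)) = expsinhc k.
  rewrite (bigD1 i0) //= mtopE eqxx muln1 big1 ?mulr1 // => i ne.
  by rewrite mtopE eq_sym (negPf ne) muln0.
have topN k : (D <= k <= D + 2 * g)%N -> ~~ odd (k - D) -> mtop k \in msupp (hurwitzP g n).
  move=> /andP[le_k ge_k] ev; rewrite mcoeff_msupp mcoeff_hurwitzP /hurwitzP_coef.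
  rewrite mtop_deg -/D le_k ge_k /= mtop_coef coef_poly ltnS le_k.
  rewrite /sinhc_coef (negPf ev) !mulf_neq0 ?factq_neq0 ?invr_neq0 ?mulf_neq0 ?expf_neq0 ?factq_neq0 //.
  apply: cscX_neq0; first by rewrite /D; lia.
  have -> : (D + 2 * g - k = 2 * g - (k - D))%N by lia.
  by rewrite oddB ?oddM ?(negPf ev) //; lia.
split.
- move=> b b_gt0; rewrite meval_hurwitzP //.
  have b_gt0' : all (ltn 0) b by [].
  have := @hurwitzHE g b N hg _ b_gt0' _; rewrite size_tuple => ->; [|exact: hn|by rewrite /N; lia].
  by rewrite !big_tuple -natr_sum sumnE big_tuple.
- exact: hurwitzP_sym.
- split.
  + move=> m; rewrite mcoeff_msupp mcoeff_hurwitzP /hurwitzP_coef.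
    by case: ifP => [/andP[l1 l2] _|_]; rewrite ?eqxx //; lia.
  + exists (mtop (4 * g + n - 3)%N) => //; apply: topN; first by rewrite /D; lia.
    have -> : (4 * g + n - 3 - D = 2 * g)%N by rewrite /D; lia.
    by rewrite oddM.
  + by exists (mtop D) => //; apply: topN; rewrite ?subnn //; lia.
split.
- move=> bs k le_b eb; rewrite /bracket ifT; last by apply/eqP; lia.
  have -> : ((4 * g - 3 + n - sumn bs) %/ 2 = k)%N by lia.
  rewrite mulrA -expr2 sqrr_sign mul1r mcoeff_hurwitzP /hurwitzP_coef mdeg_mono_of -/D.
  rewrite Chat_expsinhc -/D.
  (* For $2g-3 \le b < D$ both sides are zero: the product in [Chat] has degree at most $b$. *)
  have [leD|ltD] := leqP D (sumn bs); last first.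
    have [sz _] := prod_top_coef (index_enum 'I_n) (fun i => size_expsinhc (mono_of bs i)).
    rewrite [X in _ * (_ * (_ * X))]nth_default ?mulr0 //.
    by apply: leq_trans sz _; rewrite -mdegE mdeg_mono_of.
  rewrite ifT; last by rewrite /D; lia.
  rewrite (@Cbgn_cscX g n _ N) // -/D; [|by rewrite leD /=; lia|by rewrite /N; lia].
  have -> : 2 ^+ (sumn bs + n) = 2 ^+ (sumn bs + 3 - 2 * g) * 2 ^+ D :> rat.
    by rewrite -exprD; congr (_ ^+ _); rewrite /D; lia.
  by field; rewrite !expf_neq0 // factq_neq0.
- move=> bs k le_b ev; rewrite /bracket ifF //; apply: contraNF ev => /eqP e.
  (* The degree condition of [bracket] forces $b + n$ to be odd, so for even $b + n$ the default
     value 0 applies. *)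
  have e' : (sumn bs + n + 2 * k = 2 * (2 * g - 2 + n) + 1)%N by lia.
  have := congr1 odd e'; rewrite [in RHS]oddD oddD !mul2n !odd_double.
  by rewrite addbF => ->.
move=> bs eb; rewrite /bracket ifT; last by apply/eqP; rewrite eb; lia.
rewrite mcoeff_hurwitzP /hurwitzP_coef mdeg_mono_of eb -/D leqnn leq_addr /= addKn.
(* In the lowest degree only the top coefficients $1/b_i!$ survive, and the Bernoulli number comes
   from the coefficient of $z^{2g}$ in $1/S$. *)
have [_ top] := prod_top_coef (index_enum 'I_n) (fun i => size_expsinhc (mono_of bs i)).
rewrite -mdegE mdeg_mono_of eb -/D in top; rewrite top.
rewrite coef_cscX; last by rewrite /=; lia.
have -> : \prod_(i < n) (expsinhc (mono_of bs i))`_(mono_of bs i) =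
   (\prod_(i < n) (tnth bs i)`!%:R)^-1.
  rewrite -prodfV; apply: eq_bigr => i _.
  by rewrite mnmE coef_poly ltnSn subnn /sinhc_coef /= expr0 mul1r invr1 mulr1.
rewrite /multinomial eb -/D natrX.
have -> : 2 ^+ (2 * g) = 2 * 2 ^+ (2 * g - 1) :> rat.
  by rewrite -exprS; congr (_ ^+ _); lia.
field.
rewrite expf_neq0 // factq_neq0 /=; apply/prodf_neq0 => i _; exact: factq_neq0.
Qed.
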